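(* Let $n\ge3$. Then: (1) $KB_n=\ker\pi_K$ contains no non-trivial abelian normal subgroup of $VB_n$; (2) $PVT_n=\ker\sigma$ contains no non-trivial abelian normal subgroup of $VT_n$; (3) $KT_n=\ker\theta$ contains no non-trivial abelian normal subgroup of $VT_n$.
   Context: The virtual braid group $VB_n$ has generators $\sigma_1,\dots,\sigma_{n-1},v_1,\dots,v_{n-1}$ and relations: $\sigma_i\sigma_{i+1}\sigma_i=\sigma_{i+1}\sigma_i\sigma_{i+1}$, $\sigma_i\sigma_j=\sigma_j\sigma_i$ ($|i-j|\ge2$); $v_i^2=1$, $v_iv_{i+1}v_i=v_{i+1}v_iv_{i+1}$, $v_iv_j=v_jv_i$ ($|i-j|\ge2$); $\sigma_iv_j=v_j\sigma_i$ ($|i-j|\ge2$), $v_iv_{i+1}\sigma_i=\sigma_{i+1}v_iv_{i+1}$. The epimorphism $\pi_K\colon VB_n\to S_n$ is given by $\pi_K(\sigma_i)=1$, $\pi_K(v_i)=(i,i+1)$. The virtual twin group $VT_n$ has generators $s_1,\dots,s_{n-1},\rho_1,\dots,\rho_{n-1}$ and relations: $s_i^2=1$, $s_is_j=s_js_i$ ($|i-j|\ge2$); $\rho_i^2=1$, $\rho_i\rho_j=\rho_j\rho_i$ ($|i-j|\ge2$), $\rho_i\rho_{i+1}\rho_i=\rho_{i+1}\rho_i\rho_{i+1}$; $\rho_is_j=s_j\rho_i$ ($|i-j|\ge2$), $\rho_i\rho_{i+1}s_i=s_{i+1}\rho_i\rho_{i+1}$. The epimorphisms $\sigma,\theta\colon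 VT_n\to S_n$ are given by $\sigma(s_i)=\sigma(\rho_i)=(i,i+1)$ and $\theta(s_i)=1$, $\theta(\rho_i)=(i,i+1)$. *)

(* Defs.v *)
(* Groups given by presentations, modelled as words in
   generators and their inverses modulo the congruence generated by free
   cancellation and the defining relations. *)
From mathcomp Require Import all_boot all_fingroup.
Set Implicit Arguments. Unset Strict Implicit. Unset Printing Implicit Defensive.

(* A letter is a generator together with an exponent flag: false = g, true = g^-1 *)
Definition letter (G : Type) := (G * bool)%type.
Definition word (G : Type) := seq (letter G).
Definition lflip G (a : letter G) : letter G := (a.1, ~~ a.2).
Definition winv G (w : word G) : word G := rev (map (@lflip G) w).

Inductive pres_eq G (R : word G -> word G -> Prop) : word G -> word G -> Prop :=
| pe_refl u : pres_eq R u u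
| pe_sym u v : pres_eq R u v -> pres_eq R v u
| pe_trans u v w : pres_eq R u v -> pres_eq R v w -> pres_eq R u w
| pe_cancel u v (a : letter G) : pres_eq R (u ++ [:: a; lflip a] ++ v) (u ++ v)
| pe_rel u v l r : R l r -> pres_eq R (u ++ l ++ v) (u ++ r ++ v).

(* N is (the preimage in words of) a normal abelian subgroup of <G | R> *)
Record normal_abelian_subgroup G (R : word G -> word G -> Prop)
    (N : word G -> Prop) : Prop := {
  nas_compat : forall u v, pres_eq R u v -> N u -> N v;
  nas_one : N [::];
  nas_mul : forall u v, N u -> N v -> N (u ++ v);
  nas_inv : forall u, N u -> N (winv u);
  nas_normal : forall u g, N u -> N (winv g ++ u ++ g);
  nas_abelian : forall u v, N u -> N v -> pres_eq R (u ++ v) (v ++ u)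
}.

Definition no_nontrivial_abelian_normal_in G (R : word G -> word G -> Prop)
    (K : word G -> Prop) : Prop :=
  forall N, normal_abelian_subgroup R N -> (forall u, N u -> K u) ->
    forall u, N u -> pres_eq R u [::].

Definition eval_perm n G (f : G -> {perm 'I_n}) (w : word G) : {perm 'I_n} :=
  foldr (fun a p => ((if a.2 then (f a.1)^-1 else f a.1) * p)%g) 1%g w.

Definition ker_perm n G (f : G -> {perm 'I_n}) : word G -> Prop :=
  fun w => eval_perm f w = 1%g.

Lemma adj_lo_lt n (i : 'I_n.-1) : (val i < n)%N.
Proof. case: i => i /= Hi; case: n Hi => [|n] //= Hi; exact: ltnW. Qed.
Lemma adj_hi_lt n (i : 'I_n.-1) : ((val i).+1 < n)%N.
Proof. case: i => i /= Hi; case: n Hi => [|n] //=. Qed.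
Definition adj_transp n (i : 'I_n.-1) : {perm 'I_n} :=
  tperm (Ordinal (adj_lo_lt i)) (Ordinal (adj_hi_lt i)).

Definition far n (i j : 'I_n) : Prop := ((val i).+1 < val j \/ (val j).+1 < val i)%N.
Definition next n (i j : 'I_n) : Prop := val j = (val i).+1.

(* VBs i = sigma_(i+1), VBv i = v_(i+1), for i : 'I_(n-1) *)
Inductive vbgen (n : nat) := VBs of 'I_n.-1 | VBv of 'I_n.-1.
Arguments VBs {n}. Arguments VBv {n}.

Definition vs {n} (i : 'I_n.-1) : letter (vbgen n) := (VBs i, false).
Definition vv {n} (i : 'I_n.-1) : letter (vbgen n) := (VBv i, false).

Inductive vb_rel n : word (vbgen n) -> word (vbgen n) -> Prop :=
| vbr_sbraid i j : next i j -> vb_rel [:: vs i; vs j; vs i] [:: vs j; vs i; vs j]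
| vbr_scomm i j : far i j -> vb_rel [:: vs i; vs j] [:: vs j; vs i]
| vbr_vsq i : vb_rel [:: vv i; vv i] [::]
| vbr_vbraid i j : next i j -> vb_rel [:: vv i; vv j; vv i] [:: vv j; vv i; vv j]
| vbr_vcomm i j : far i j -> vb_rel [:: vv i; vv j] [:: vv j; vv i]
| vbr_mcomm i j : far i j -> vb_rel [:: vs i; vv j] [:: vv j; vs i]
| vbr_mixed i j : next i j -> vb_rel [:: vv i; vv j; vs i] [:: vs j; vv i; vv j].

Definition piK_gen n (g : vbgen n) : {perm 'I_n} :=
  match g with VBs _ => 1%g | VBv i => adj_transp i end.

(* VTs i = s_(i+1), VTr i = rho_(i+1) *)
Inductive vtgen (n : nat) := VTs of 'I_n.-1 | VTr of 'I_n.-1.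
Arguments VTs {n}. Arguments VTr {n}.

Definition ts {n} (i : 'I_n.-1) : letter (vtgen n) := (VTs i, false).
Definition tr {n} (i : 'I_n.-1) : letter (vtgen n) := (VTr i, false).

Inductive vt_rel n : word (vtgen n) -> word (vtgen n) -> Prop :=
| vtr_ssq i : vt_rel [:: ts i; ts i] [::]
| vtr_scomm i j : far i j -> vt_rel [:: ts i; ts j] [:: ts j; ts i]
| vtr_rsq i : vt_rel [:: tr i; tr i] [::]
| vtr_rcomm i j : far i j -> vt_rel [:: tr i; tr j] [:: tr j; tr i]
| vtr_rbraid i j : next i j -> vt_rel [:: tr i; tr j; tr i] [:: tr j; tr i; tr j]
| vtr_mcomm i j : far i j -> vt_rel [:: tr i; ts j] [:: ts j; tr i]
| vtr_mixed i j : next i j -> vt_rel [:: tr i; tr j; ts i] [:: ts j; tr i; tr j].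

Definition sigma_gen n (g : vtgen n) : {perm 'I_n} :=
  match g with VTs i => adj_transp i | VTr i => adj_transp i end.
Definition theta_gen n (g : vtgen n) : {perm 'I_n} :=
  match g with VTs _ => 1%g | VTr i => adj_transp i end.

(* Main.v *)
(* KB_n (resp. KT_n) is the Artin (resp. right-angled Coxeter) group G whose
   generators are the ordered pairs of distinct strands, two of them having
   product of order 2, 3 or infinity according to how the pairs overlap.  A word
   of the virtual group is rewritten into G by carrying along the permutation
   of the strands; by Coxeter's presentation of S_n this determines the word.

   In such a graph group, if m(s,t) is infinite then G is the amalgam of
   A = <S \ s> and B = <S \ t> along A /\ B.  If g belongs to an abelian normal
   subgroup N but not to A /\ B, then up to conjugacy g and a well chosen
   conjugate of g do not commute, by the normal form theorem; hence N is
   contained in A /\ B.  Thus N is contained in <S \ t> for every t.  The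
   Charney-Paris set retraction of G onto a standard parabolic subgroup gives
   <X> /\ <Y> = <X /\ Y>, so that N is trivial.

   For PVT_n: N meets ker theta trivially, hence centralizes it, and an element
   with non-trivial image under theta moves some generator of ker theta modulo
   commutators; so N is contained in ker theta. *)
From HB Require Import structures.
Require Import Defs.
From mathcomp Require Import all_boot all_fingroup.
From mathcomp Require Import all_order all_algebra.
From mathcomp Require Import boolp zify ring.
Set Implicit Arguments. Unset Strict Implicit. Unset Printing Implicit Defensive.
Import GRing.Theory Num.Theory.
Local Open Scope group_scope.

(** * Presented groups *)

(** The obstacle in the amalgam is an element [g] with a reduced expression of even length: no
    rotation shortens it, and a careless conjugate of [g] may cancel against it. A conjugator [a] in
    [A] is good when [a], [a^-1 x] and [a x] avoid [B], where [x] is the first factor of [g]. Three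
    powers [z], [z^2], [z^3] outside [B] always contain a good one. Such a [z] is [t u], with m(t,u)
    infinite and [u] distinct from [s]; so each generator needs two partners at infinity. For the
    pair (a,b) these are (b,a) and (a,c) with [c] a third strand, which is where n >= 3 enters.

    One reflection representation, integral because only the labels 2, 3 and infinity occur, does
    three jobs: signs of roots drive the retraction, coefficients show that an element is outside a
    parabolic subgroup, and faithfulness yields Coxeter's presentation of S_n.

    The amalgamated subgroup is the intersection of [A] and [B] inside G, so the factors embed by
    construction and generators of the intersection are found only later, by the retraction. *)

Section PresentedGroup.
Variables (T : Type) (R : word T -> word T -> Prop).

Lemma pres_eq_catl w u v : pres_eq R u v -> pres_eq R (w ++ u) (w ++ v).
Proof.
elim=> {u v} [u|u v _|u v x _ + _|u v a|u v l r lr]; first exact: pe_refl.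
- exact: pe_sym.
- exact: pe_trans.
- by rewrite !catA -!(catA (w ++ u)); exact: pe_cancel.
- by rewrite !catA -!(catA (w ++ u)); exact: pe_rel.
Qed.

Lemma pres_eq_catr w u v : pres_eq R u v -> pres_eq R (u ++ w) (v ++ w).
Proof.
elim=> {u v} [u|u v _|u v x _ + _|u v a|u v l r lr]; first exact: pe_refl.
- exact: pe_sym.
- exact: pe_trans.
- by rewrite -!catA; exact: pe_cancel.
- by rewrite -!catA; exact: pe_rel.
Qed.

Lemma pres_eq_cat u u' v v' :
  pres_eq R u u' -> pres_eq R v v' -> pres_eq R (u ++ v) (u' ++ v').
Proof.
move=> uu vv; apply: pe_trans (pres_eq_catr _ uu) _; exact: pres_eq_catl.
Qed.

Lemma winv_cat (u v : word T) : winv (u ++ v) = winv v ++ winv u.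
Proof. by rewrite /winv map_cat rev_cat. Qed.

Lemma lflipK : involutive (@lflip T).
Proof. by case=> x e; rewrite /lflip /= negbK. Qed.

Lemma winvK : involutive (@winv T).
Proof. by move=> u; rewrite /winv map_rev revK mapK //; exact: lflipK. Qed.

Lemma winv_cons a (u : word T) : winv (a :: u) = winv u ++ [:: lflip a].
Proof. by rewrite -cat1s winv_cat. Qed.

Lemma pres_eq_mulV u : pres_eq R (u ++ winv u) [::].
Proof.
elim: u => [|a u IH]; first exact: pe_refl.
rewrite winv_cons catA; apply: pe_trans (pe_cancel R [::] [::] a).
exact: (pres_eq_catl [:: a] (pres_eq_catr [:: lflip a] IH)).
Qed.

Lemma pres_eq_Vmul u : pres_eq R (winv u ++ u) [::].
Proof. by rewrite -{2}(winvK u); exact: pres_eq_mulV. Qed.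

Lemma pres_eq_winv u v : pres_eq R u v -> pres_eq R (winv u) (winv v).
Proof.
move=> uv; apply: pe_trans (_ : pres_eq R (winv u ++ v ++ winv v) _).
  rewrite -{1}(cats0 (winv u)); apply: pres_eq_catl; apply: pe_sym; exact: pres_eq_mulV.
rewrite catA -[X in pres_eq R _ X]cat0s; apply: pres_eq_catr.
apply: pe_trans (pres_eq_catl (winv u) (pe_sym uv)) _; exact: pres_eq_Vmul.
Qed.

(* Elements are the classes themselves, so that equality in the presented
   group is Leibniz equality. *)
Definition gp := {P : word T -> Prop | exists u, P = pres_eq R u}.

Definition cls (u : word T) : gp := exist _ (pres_eq R u) (ex_intro _ u erefl).

Lemma clsP u v : cls u = cls v <-> pres_eq R u v.
Proof.
split=> [[E]|uv]; first by rewrite E; exact: pe_refl.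
apply: eq_exist; apply: funext => w; apply: propext; split=> [uw|].
  exact: pe_trans (pe_sym uv) uw.
exact: pe_trans.
Qed.

Lemma cls_surj (x : gp) : exists u, cls u = x.
Proof. by case: x => P [u uP]; exists u; apply: eq_exist; rewrite uP. Qed.

Definition rep (x : gp) : word T := projT1 (cid (cls_surj x)).
Lemma repK x : cls (rep x) = x. Proof. exact: projT2 (cid (cls_surj x)). Qed.

Definition gp_mul x y := cls (rep x ++ rep y).
Definition gp_inv x := cls (winv (rep x)).

Lemma gp_mulE u v : gp_mul (cls u) (cls v) = cls (u ++ v).
Proof. by apply/clsP; apply: pres_eq_cat; apply/clsP; rewrite repK. Qed.
Lemma gp_invE u : gp_inv (cls u) = cls (winv u).
Proof. by apply/clsP; apply: pres_eq_winv; apply/clsP; rewrite repK. Qed.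

Fact gp_mulA : associative gp_mul.
Proof.
by move=> x y z; rewrite -(repK x) -(repK y) -(repK z) !gp_mulE catA.
Qed.
Fact gp_mul1 : left_id (cls [::]) gp_mul.
Proof. by move=> x; rewrite -(repK x) gp_mulE. Qed.
Fact gp_1mul : right_id (cls [::]) gp_mul.
Proof. by move=> x; rewrite -(repK x) gp_mulE cats0. Qed.
Fact gp_mulVx : left_inverse (cls [::]) gp_inv gp_mul.
Proof. by move=> x; rewrite -(repK x) gp_invE gp_mulE; apply/clsP/pres_eq_Vmul. Qed.
Fact gp_mulxV : right_inverse (cls [::]) gp_inv gp_mul.
Proof. by move=> x; rewrite -(repK x) gp_invE gp_mulE; apply/clsP/pres_eq_mulV. Qed.

HB.instance Definition _ := gen_eqMixin gp.
HB.instance Definition _ := gen_choiceMixin gp.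
HB.instance Definition _ :=
  isGroup.Build gp gp_mulA gp_mul1 gp_1mul gp_mulVx gp_mulxV.

Lemma cls_cat u v : cls (u ++ v) = cls u * cls v.
Proof. exact: esym (gp_mulE u v). Qed.
Lemma cls_winv u : cls (winv u) = (cls u)^-1.
Proof. exact: esym (gp_invE u). Qed.
Lemma cls0 : cls [::] = 1. Proof. by []. Qed.

Definition gen t : gp := cls [:: (t, false)].

Definition lval (a : letter T) : gp := if a.2 then (gen a.1)^-1 else gen a.1.

Lemma cls1 a : cls [:: a] = lval a.
Proof. by case: a => t [] //; rewrite /lval /= /gen -cls_winv. Qed.
Lemma lval_flip a : lval (lflip a) = (lval a)^-1.
Proof. by case: a => t [] /=; rewrite /lval //= invgK. Qed.
Lemma cls_cons a u : cls (a :: u) = lval a * cls u.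
Proof. by rewrite -cat1s cls_cat cls1. Qed.
Lemma cls_rcons a u : cls (rcons u a) = cls u * lval a.
Proof. by rewrite -cats1 cls_cat cls1. Qed.

Lemma cls_rel l r : R l r -> cls l = cls r.
Proof.
by move=> lr; apply/clsP; have := pe_rel [::] [::] lr; rewrite /= !cats0.
Qed.

(* The universal property, in the form of an action on [Omega] restricted to
   an invariant subset [inv]. *)
Lemma pres_eq_foldl (Omega : Type) (f : Omega -> letter T -> Omega)
    (inv : Omega -> Prop) :
  (forall o a, inv o -> inv (f o a)) ->
  (forall o a, inv o -> f (f o a) (lflip a) = o) ->
  (forall o l r, inv o -> R l r -> foldl f o l = foldl f o r) ->
  forall u v, pres_eq R u v -> forall o, inv o -> foldl f o u = foldl f o v.
Proof.
move=> finv fK frel; have invf u o : inv o -> inv (foldl f o u).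
  by elim: u o => //= a u IH o io; apply/IH/finv.
move=> u v; elim=> {u v} [//|u v _ IH o io|u v w _ IH1 _ IH2 o io|u v a o io|u v l r lr o io].
- by rewrite IH.
- by rewrite IH1 // IH2.
- by rewrite !foldl_cat /= fK //; exact: invf.
- by rewrite !foldl_cat (frel _ l r) //; exact: invf.
Qed.

Definition sub (X : pred T) (x : gp) : Prop :=
  exists2 u, cls u = x & all (fun a => X a.1) u.

Lemma sub1 X : sub X 1. Proof. by exists [::]. Qed.
Lemma subM X x y : sub X x -> sub X y -> sub X (x * y).
Proof.
case=> u <- Xu [v <- Xv]; exists (u ++ v); first by rewrite cls_cat.
by rewrite all_cat Xu.
Qed.
Lemma sub_lval (X : pred T) a : X a.1 -> sub X (lval a).
Proof. by move=> Xa; exists [:: a]; rewrite ?cls1 //= Xa. Qed.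
Lemma sub_gen (X : pred T) t : X t -> sub X (gen t).
Proof. exact: (@sub_lval X (t, false)). Qed.

Lemma sub_ind (X : pred T) (P : gp -> Prop) : P 1 ->
  (forall a x, X a.1 -> P x -> P (lval a * x)) -> forall x, sub X x -> P x.
Proof.
move=> P1 PM x [u <-]; elim: u => // a u IH /= /andP[Xa Xu].
by rewrite cls_cons; apply: PM => //; exact: IH.
Qed.

Lemma subV X x : sub X x -> sub X x^-1.
Proof.
move: x; apply: sub_ind => [|a x Xa IH]; first by rewrite invg1; exact: sub1.
by rewrite invgM; apply: subM => //; rewrite -lval_flip; exact: sub_lval.
Qed.

Lemma subS (X Y : pred T) x : (forall t, X t -> Y t) -> sub X x -> sub Y x.
Proof.
by move=> XY [u <- Xu]; exists u => //; apply: sub_all Xu => a; exact: XY.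
Qed.

Lemma sub_full x : sub predT x.
Proof. by case: (cls_surj x) => u <-; exists u => //; exact: all_predT. Qed.

Lemma sub_none x : sub pred0 x -> x = 1.
Proof. by move: x; apply: sub_ind. Qed.

End PresentedGroup.

(** * Abelian normal subgroups of amalgams *)

Section AlternatingProducts.
Variables (G : groupType) (A B : G -> Prop).

Record subgroup (H : G -> Prop) : Prop := Subgroup {
  sg1 : H 1; sgM : forall x y, H x -> H y -> H (x * y);
  sgV : forall x, H x -> H x^-1 }.

Definition side (b : bool) := if b then A else B.
Definition off b x := side b x /\ ~ side (~~ b) x.

Fixpoint alt (b : bool) (l : seq G) : Prop :=
  if l is x :: l' then off b x /\ alt (~~ b) l' else True.

Lemma alt_cons b x l : alt b (x :: l) = (off b x /\ alt (~~ b) l).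
Proof. by []. Qed.

Definition prodl (l : seq G) : G := foldr (fun x y => x * y) 1 l.

Lemma prodl_cat l1 l2 : prodl (l1 ++ l2) = prodl l1 * prodl l2.
Proof. by elim: l1 => [|x l1 /= ->]; rewrite ?mul1g ?mulgA. Qed.

Lemma alt_cat b l1 l2 :
  alt b (l1 ++ l2) <-> alt b l1 /\ alt (b (+) odd (size l1)) l2.
Proof.
elim: l1 b => [|x l1 IH] b /=; first by rewrite addbF; tauto.
have -> : b (+) ~~ odd (size l1) = ~~ b (+) odd (size l1) by rewrite addbN addNb.
by have := IH (~~ b); tauto.
Qed.

Hypotheses (sA : subgroup A) (sB : subgroup B).

Lemma side_sg b : subgroup (side b). Proof. by case: b. Qed.

Lemma sideM b x y : side b x -> side b y -> side b (x * y).
Proof. exact: sgM (side_sg b) x y. Qed.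
Lemma sideV b x : side b x -> side b x^-1.
Proof. exact: sgV (side_sg b) x. Qed.
Lemma sideMl b x y : side b x -> side b (x * y) <-> side b y.
Proof.
move=> sx; split; last exact: sideM.
by move=> /(sideM (sideV sx)); rewrite mulKg.
Qed.
Lemma sideMr b x y : side b y -> side b (x * y) <-> side b x.
Proof.
move=> sy; split=> [|sx]; last exact: sideM.
by move=> /sideM /(_ (sideV sy)); rewrite mulgK.
Qed.
Lemma sideVE b x : side b x^-1 <-> side b x.
Proof. by split=> [/sideV|/sideV //]; rewrite invgK. Qed.

Lemma offV b x : off b x -> off b x^-1.
Proof. by case=> sx nx; split; [exact: sideV | rewrite sideVE]. Qed.
Lemma offMC b x y : off b x -> side b y -> side (~~ b) y -> off b (x * y).
Proof.
by case=> sx nx sy sy'; split; [exact: sideM | rewrite (sideMr _ sy')].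
Qed.

Lemma prodl_rev l : prodl (rev (map (fun x => x^-1) l)) = (prodl l)^-1.
Proof.
elim: l => [|x l IH]; first by rewrite invg1.
by rewrite /= rev_cons -cats1 prodl_cat IH /= mulg1 invgM.
Qed.

Lemma alt_rev b l : alt b l ->
  alt (b (+) ~~ odd (size l)) (rev (map (fun x => x^-1) l)).
Proof.
elim: l b => //= x l IH b [ox al].
rewrite rev_cons -cats1 alt_cat size_rev size_map; split.
  by have := IH _ al; rewrite addNb !addbN !negbK.
split=> //; have -> : b (+) ~~ ~~ odd (size l) (+) odd (size l) = b.
  by rewrite negbK -addbA addbb addbF.
exact: offV.
Qed.

Hypothesis gen_side : forall P : G -> Prop, P 1 ->
  (forall b x y, side b x -> P y -> P (x * y)) -> forall x, P x.

(** A new left factor is absorbed by the first letter if it lies in both sides, and merged with it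
    if both lie on the same side; a merged letter that falls into the intersection is passed on to
    the next one. *)
Lemma alt_form x : (A x /\ B x) \/ exists b l, alt b l /\ l <> [::] /\ prodl l = x.
Proof.
move: x; apply: gen_side; first by left; split; [exact: sg1 sA | exact: sg1 sB].
have sidebb b x : side b x -> side (~~ b) x -> A x /\ B x by case: b.
move=> b x y sx [[yA yB]|[b' [l [al [nl <-]]]]].
  have yb : side (~~ b) y by case: {+}b.
  have yb' : side b y by case: {+}b.
  case: (pselect (side (~~ b) x)) => [nx|nx].
    by left; split; case: b sx nx yb yb' => /= *; 
       [exact: sgM sA _ _ _ _|exact: sgM sA _ _ _ _|exact: sgM sB _ _ _ _|exact: sgM sB _ _ _ _].
  right; exists b, [:: x * y]; split=> /=; last by rewrite mulg1.
  by split=> //; exact: offMC.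
case: (pselect (side (~~ b) x)) => [nx|nx].
  right; case: l al nl => // z l [[oz nz] al] _; exists b', (x * z :: l).
  have xb : side b' x by case: {+}b' {+}b sx nx => [] [].
  have xb' : side (~~ b') x by case: {+}b' {+}b sx nx => [] [].
  split=> /=; last by rewrite mulgA.
  by split=> //; split; [exact: sideM|rewrite sideMl].
case: (eqVneq b b') => [eb|neb]; last first.
  right; exists b, (x :: l); split=> //=; split=> //.
  by have -> : ~~ b = b' by case: {+}b {+}b' neb => [] [].
rewrite -{b'}eb in al *; case: l al nl => // z l [[oz nz] al] _.
case: (pselect (side (~~ b) (x * z))) => [nxz|nxz]; last first.
  right; exists b, (x * z :: l); split=> /=; last by rewrite mulgA.
  by split=> //; split=> //; exact: sideM.
have sxz := sideM sx oz.
case: l al => [|w l] al.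
  by left; rewrite /= mulg1; apply: sidebb nxz.
right; exists (~~ b), (x * z * w :: l); split; last by rewrite /= !mulgA.
move: al; rewrite alt_cons => -[[ow nw] al]; split=> //; split; first exact: sideM.
by rewrite negbK in nw *; rewrite sideMl.
Qed.

Hypothesis alt_neq1 : forall b l, alt b l -> l <> [::] -> prodl l <> 1.

Variable N : G -> Prop.
Hypotheses (NJ : forall x g, N x -> N (g^-1 * (x * g)))
           (Nab : forall x y, N x -> N y -> x * y = y * x).
(** The powers of [z] supply three candidate conjugators in [A], while [s] only witnesses that [B]
    is not contained in [A]. *)
Variables (z s : G).
Hypotheses (zA : A z) (z1 : ~ B z) (z2 : ~ B (z * z)) (z3 : ~ B (z * (z * z)))
           (sB' : B s) (sA' : ~ A s).

(** The commutator of [x] with [y^-1 x y] is an alternating product of eight factors, hence not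
    1. *)
Let NC b x y : off b x -> off (~~ b) y -> ~ N x.
Proof.
move=> ox oy Nx; have ox' := offV ox; have oy' := offV oy.
have := @alt_neq1 b [:: x; y^-1; x; y; x^-1; y^-1; x^-1; y].
rewrite /= !negbK; case=> //.
have /(congr1 (fun u => u * (x^-1 * (y^-1 * (x^-1 * y))))) := Nab Nx (NJ y Nx).
by rewrite mulg1 -!mulgA => ->; rewrite !mulVKg mulVg.
Qed.

(** [a^-1 x] lies in [B] for at most one left coset [a B], and [a x] for at most one right coset
    [B a]. The elements [z], [z^2], [z^3] lie in distinct cosets on either side, so one of the three
    survives. *)
Let zcand x : exists a, [/\ A a, ~ B a, ~ B (a^-1 * x) & ~ B (a * x)].
Proof.
have cand a a' : B (a^-1 * x) -> B (a'^-1 * x) -> B (a^-1 * a').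
  move=> h h'; have := sgM sB h (sgV sB h').
  by rewrite invgM invgK mulgA mulgK.
have cand' a a' : B (a * x) -> B (a' * x) -> B (a' * a^-1).
  move=> h h'; have := sgM sB h' (sgV sB h).
  by rewrite invgM mulgA mulgK.
have zz : A (z * z) by exact: sgM sA _ _ _ _.
have zzz : A (z * (z * z)) by exact: sgM sA _ _ _ _.
have c12 : z^-1 * (z * z) = z by rewrite mulKg.
have c13 : z^-1 * (z * (z * z)) = z * z by rewrite mulKg.
have d12 : z * z * z^-1 = z by rewrite mulgK.
have d13 : z * (z * z) * z^-1 = z * z by rewrite mulgA mulgK.
have d23 : z * (z * z) * (z * z)^-1 = z by rewrite mulgK.
have c23 : (z * z)^-1 * (z * (z * z)) = z by rewrite [z * (z * z)]mulgA mulKg.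
case: (pselect (B (z^-1 * x))) => h1.
  have n2 : ~ B ((z * z)^-1 * x) by move=> /(cand _ _ h1); rewrite c12.
  have n3 : ~ B ((z * (z * z))^-1 * x) by move=> /(cand _ _ h1); rewrite c13.
  case: (pselect (B (z * z * x))) => k2; last by exists (z * z).
  exists (z * (z * z)); split=> // k3.
  by have := cand' _ _ k2 k3; rewrite d23.
case: (pselect (B (z * x))) => k1; last by exists z.
have n2 : ~ B (z * z * x) by move=> /(cand' _ _ k1); rewrite d12.
have n3 : ~ B (z * (z * z) * x) by move=> /(cand' _ _ k1); rewrite d13.
case: (pselect (B ((z * z)^-1 * x))) => k2; last by exists (z * z).
exists (z * (z * z)); split=> // k3.
by have := cand _ _ k2 k3; rewrite c23.
Qed.

(* If g = x m lies in N, then for a suitable a in A the product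
   g (a^-1 g a) g^-1 (a^-1 g^-1 a) is reduced as it stands. *)
Let Neven x m : odd (size m) -> alt true (x :: m) -> ~ N (x * prodl m).
Proof.
move=> om [ox am] Ng; have [a [aA aB ax xa]] := zcand x.
have [xA xB] := ox.
(* Since [m] begins and ends on side [B], the only merged factors are [a^-1 x], the inverse of [a x]
   and the inverse of [a^-1 x], all kept out of [B] by the choice of [a]. *)
have := @alt_neq1 true (x :: m ++ (a^-1 * x) :: m ++ a :: rev (map (fun x => x^-1) m)
   ++ (x^-1 * a^-1) :: rev (map (fun x => x^-1) m) ++ [:: x^-1 * a]).
have am' := alt_rev am; rewrite om /= in am'.
have o1 : off true (a^-1 * x) by split=> //; apply: (@sideM true) => //; exact: (@sideV true).
have o2 : off true (x^-1 * a^-1).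
  rewrite -invgM; split; first by apply: (@sideV true); apply: (@sideM true).
  by rewrite (@sideVE false).
have o3 : off true (x^-1 * a).
  by have := offV o1; rewrite invgM invgK.
have o4 : off true a by split.
case=> //.
  rewrite /= !alt_cat /= !alt_cat /= !alt_cat /= !alt_cat /= !size_rev !size_map om /=.
  by do 10!(split=> //).
rewrite /= !prodl_cat /= !prodl_cat /= !prodl_cat /= !prodl_cat /= !prodl_rev mulg1.
have := Nab Ng (NJ a Ng); set M := prodl m.
move=> /(congr1 (fun u => u * (M^-1 * (x^-1 * (a^-1 * (M^-1 * (x^-1 * a))))))).
rewrite -!mulgA => ->.
by rewrite !mulVKg mulVg.
Qed.

(** Conjugation lets the expression be rotated. In even length it is rotated to start in [A], where
    [Neven] applies; in odd length the two end letters share a side, and rotation merges them into a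
    shorter expression. Length one is [NC]. *)
Let Nalt n b l : (size l <= n)%N -> l <> [::] -> alt b l -> ~ N (prodl l).
Proof.
elim: n b l => [|n IH] b [|x l] // szl _ al Ng.
have os : off false s by split.
have oz : off true z by split.
case: (posnP (size l)) => [/size0nil l0|lpos].
  move: al Ng; rewrite {}l0 /= mulg1 => -[ox _]; case: b ox => ox.
    exact: NC ox os.
  exact: NC ox oz.
have Ngx : N (prodl (l ++ [:: x])).
  by rewrite prodl_cat /= mulg1; have := NJ x Ng; rewrite /= -mulgA mulKg.
case: (boolP (odd (size l))) => ol.
  case: b al => al; first exact: Neven ol al Ng.
  have: alt true (l ++ [:: x]).
    by move: al; rewrite alt_cons alt_cat ol /= => -[].
  have : size (l ++ [:: x]) = (size l).+1 by rewrite size_cat addn1.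
  case: l ol {szl al lpos Ng} Ngx => // y l ol Ngx [sz] al.
  by apply: Neven al Ngx; rewrite sz.
move: ol Ngx al lpos szl; case/lastP: l Ng => // l y Ng ol Ngx al _ szl.
rewrite size_rcons oddS negbK in ol; rewrite /= size_rcons in szl; rewrite -cats1 in Ngx al.
move: Ngx; rewrite -catA prodl_cat /= mulg1 => Ngx.
move: al; rewrite alt_cons alt_cat ol addbT negbK => -[[ox nx]] [al] /= [[oy ny] _].
have [al'|nyx] := pselect (side (~~ b) (y * x)); last first.
  apply: (IH (~~ b) (l ++ [:: y * x])); rewrite ?size_cat ?addn1 //.
  - by case: (l).
  - rewrite alt_cat ol addbT negbK /=; do !split=> //; exact: sideM.
  - by rewrite prodl_cat /= mulg1.
(* Here [y * x] lies in both sides, so it is absorbed by the preceding letter [w] and the length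
   drops by two. *)
move: ol al Ngx szl; case/lastP: l Ng => // l w Ng ol al Ngx szl.
rewrite size_rcons oddS in ol; rewrite size_rcons in szl; rewrite -cats1 in Ngx al.
apply: (IH (~~ b) (l ++ [:: w * (y * x)])); rewrite ?size_cat ?addn1 //.
- exact: ltnW.
- by case: (l).
- move: al; rewrite !alt_cat; rewrite (negbTE ol) addbF; case=> al [ow _]; do 2!split=> //.
  have yx : side b (y * x) by exact: sideM.
  by apply: offMC; rewrite ?negbK.
- by move: Ngx; rewrite !prodl_cat /= !mulg1 -!mulgA.
Qed.

Lemma abelian_normal_in_amalgam x : N x -> A x /\ B x.
Proof.
move=> Nx; case: (alt_form x) => // -[b [l [al [nl E]]]].
by case: (Nalt (leqnn _) nl al); rewrite E.
Qed.

End AlternatingProducts.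

(** * The normal form theorem for amalgams, by van der Waerden's action on normal forms *)

Section AmalgamNormalForm.
Variables (T : Type) (R : word T -> word T -> Prop) (XA XB : pred T).
Hypothesis cover : forall t, XA t || XB t.
Hypothesis supp : forall l r, R l r ->
  all (fun a => XA a.1) (l ++ r) \/ all (fun a => XB a.1) (l ++ r).

Let G : groupType := gp R.
Let A : G -> Prop := sub XA.
Let B : G -> Prop := sub XB.
Let C (x : G) := A x /\ B x.

Lemma sub_subgroup (X : pred T) : subgroup (sub X : G -> Prop).
Proof. by split; [exact: sub1 | exact: subM | exact: subV]. Qed.

Let sA : subgroup A := sub_subgroup XA.
Let sB : subgroup B := sub_subgroup XB.
Local Notation sd := (@side G A B).
Local Notation offs := (@off G A B).

Let C_side x b : C x -> sd b x. Proof. by case=> ? ?; case: b. Qed.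
Let sideC x b : sd b x -> sd (~~ b) x -> C x. Proof. by case: b. Qed.
Let CM x y : C x -> C y -> C (x * y).
Proof. by case=> ? ? [? ?]; split; [exact: sgM sA _ _ _ _|exact: sgM sB _ _ _ _]. Qed.
Let CV x : C x -> C x^-1.
Proof. by case=> ? ?; split; [exact: sgV sA _ _|exact: sgV sB _ _]. Qed.
Let C1 : C 1. Proof. by split; exact: sub1. Qed.

Let coset_ex (y : G) : exists x : G, `[< C (x^-1 * y) >].
Proof. by exists y; apply/asboolP; rewrite mulVg. Qed.

(* [tau] selects representatives of the left cosets of [C]. *)
Let tau y : G := xchoose (coset_ex y).

Let tauC y : C ((tau y)^-1 * y).
Proof. exact/asboolP/(xchooseP (coset_ex y)). Qed.

Let tauMC y c : C c -> tau (y * c) = tau y.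
Proof.
move=> Cc; apply: eq_xchoose => x; apply/asboolP/asboolP => [h|h]; last first.
  by rewrite mulgA; exact: CM.
by have := CM h (CV Cc); rewrite mulgA mulgK.
Qed.

Let tauK y : tau (tau y) = tau y.
Proof. by rewrite -{2}(mulVKg (tau y) y) tauMC. Qed.

Let tauE y : tau y = y * ((tau y)^-1 * y)^-1.
Proof. by rewrite invgM invgK mulVKg. Qed.

Let off_tau b y : sd b y -> ~ C y -> offs b (tau y).
Proof.
move=> sy ny; have sx : sd b (tau y).
  by rewrite tauE; apply: sideM => //; apply: sideV => //; exact: C_side.
split=> // /(sideC sx) Cx; apply: ny; rewrite -(mulVKg (tau y) y); exact: CM.
Qed.

(** The pair (x1 :: ... :: xk, c) stands for the product xk ... x1 c, the representative nearest to
    [c] being the head of the list. To multiply on the right by an element of side [b], [split_at]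
    first takes x1 back into the element if x1 is on that side, and [join] then extracts a new
    representative. *)
Let Om := (seq G * G)%type.

Let split_at b (o : Om) : Om :=
  if o.1 is x :: l then if `[< sd b x >] then (l, x * o.2) else o else o.
Let join (o : Om) : Om :=
  if `[< C o.2 >] then o else (tau o.2 :: o.1, (tau o.2)^-1 * o.2).
Let mact b (o : Om) y : Om :=
  join ((split_at b o).1, (split_at b o).2 * y).

Fixpoint normal_seq b (l : seq G) : Prop :=
  if l is x :: l' then [/\ offs b x, tau x = x & normal_seq (~~ b) l'] else True.

Let valid (o : Om) := C o.2 /\ exists b, normal_seq b o.1.
(** The intermediate states of a multiplication on side [b]: [split_at b] and [join] are inverse
    bijections between the valid states and these. *)
Let cut b (o : Om) := sd b o.2 /\ normal_seq (~~ b) o.1.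

Let join_valid b o : cut b o -> valid (join o).
Proof.
case: o => l y [/= sy nl]; rewrite /join /=; case: asboolP => Cy.
  by split=> //; exists (~~ b).
by split=> //=; exists b; split=> //; exact: off_tau.
Qed.

Let joinK b o : cut b o -> split_at b (join o) = o.
Proof.
case: o => l y [/= sy nl]; rewrite /join /=; case: asboolP => Cy.
  case: l nl => // x l [[_ nx] _ _]; rewrite /split_at /=.
  by case: asboolP => // sx; case: nx; rewrite negbK.
rewrite /split_at /= mulVKg; case: asboolP => // -[].
by case: (off_tau sy Cy).
Qed.

Let split_cut b o : valid o -> cut b (split_at b o).
Proof.
case: o => l c [/= Cc [b' nl]]; have sc := C_side b Cc.
case: l nl => [|x l] //= [[sx nx] tx nl]; rewrite /split_at /=.
case: asboolP => sbx; split=> //=; first exact: sideM.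
  by case: (eqVneq b b') sbx => [->//|]; case: {+}b {+}b' nx => [] [].
have -> : ~~ b = b' by case: {+}b {+}b' sbx sx => [] [].
by split=> //; split.
Qed.

Let splitK b o : valid o -> join (split_at b o) = o.
Proof.
case: o => l c [/= Cc [b' nl]]; have jc l' : join (l', c) = (l', c).
  by rewrite /join /=; case: asboolP.
case: l nl => [_|x l [[sx nx] tx nl]]; first exact: jc.
 rewrite /split_at /=.
case: asboolP => sbx //; rewrite /join /= tauMC // tx mulKg; case: asboolP => // Cxc.
by case: nx; apply: C_side; have := CM Cxc (CV Cc); rewrite mulgK.
Qed.

Let cutM b o y : cut b o -> sd b y -> cut b (o.1, o.2 * y).
Proof. by case=> so no sy; split=> //; exact: sideM. Qed.

Let mact_valid b o y : valid o -> sd b y -> valid (mact b o y).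
Proof. by move=> vo sy; apply: (@join_valid b); apply: cutM sy; exact: split_cut. Qed.

Let mactM b o y z : valid o -> sd b y -> mact b (mact b o y) z = mact b o (y * z).
Proof.
move=> vo sy; rewrite {1}/mact /mact (@joinK b) ?mulgA //.
by apply: cutM sy; exact: split_cut.
Qed.

Let mact1 b o : valid o -> mact b o 1 = o.
Proof. by move=> vo; rewrite /mact mulg1 -surjective_pairing splitK. Qed.

(** Elements of the intersection act alike through both sides, so a letter common to [XA] and [XB]
    may be read on either one. *)
Let mactC b o c : valid o -> C c -> mact b o c = (o.1, o.2 * c).
Proof.
case: o => l d [/= Cd [b' nl]] Cc; rewrite /mact; have Cdc := CM Cd Cc.
have jc l' : join (l', d * c) = (l', d * c).
  by rewrite /join /=; case: asboolP.
case: l nl => [_|x l [[sx nx] tx nl]]; first exact: jc.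
 rewrite /split_at /=.
case: asboolP => sbx //=; rewrite -mulgA /join /= tauMC // tx mulKg; case: asboolP => // Cxc.
by case: nx; apply: C_side; have := CM Cxc (CV Cdc); rewrite mulgK.
Qed.

Let step (o : Om) (a : letter T) := mact (XA a.1) o (lval R a).

Let X b := if b then XA else XB.

Let side_lval b a : X b a.1 -> sd b (lval R a).
Proof. by case: b; exact: sub_lval. Qed.

Let step_side b o a : valid o -> X b a.1 -> step o a = mact b o (lval R a).
Proof.
move=> vo Xa; rewrite /step; case: (boolP (XA a.1)) => XAa.
  case: b Xa => //= XBa.
  by have Ca : C (lval R a); [split; exact: sub_lval | rewrite !mactC].
by case: b Xa => //= XAa'; rewrite XAa' in XAa.
Qed.

Let X_own (a : letter T) : X (XA a.1) a.1.
Proof. by move: (cover a.1); rewrite /X; case: ifP. Qed.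

Let step_valid o a : valid o -> valid (step o a).
Proof. by move=> vo; apply: mact_valid => //; exact/side_lval/X_own. Qed.

Let foldl_step b u o : valid o -> all (fun a => X b a.1) u ->
  foldl step o u = mact b o (cls R u).
Proof.
elim: u o => [|a u IH] o vo /=; first by rewrite mact1.
case/andP=> Xa Xu; rewrite IH //; last exact: step_valid.
by rewrite (step_side vo Xa) mactM ?cls_cons //; exact: side_lval.
Qed.

Let stepP u v : pres_eq R u v -> forall o, valid o -> foldl step o u = foldl step o v.
Proof.
apply: pres_eq_foldl => [o a|o a vo|o l r vo lr]; first exact: step_valid.
  rewrite (step_side _ (X_own _)); last exact: step_valid.
  have sa := side_lval (X_own a).
  by rewrite /step mactM // lval_flip mulgV mact1.
have [b] : exists b, all (fun a => X b a.1) (l ++ r).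
  by case: (supp lr) => h; [exists true | exists false].
by rewrite all_cat => /andP[hl hr]; rewrite !(@foldl_step b) // (cls_rel lr).
Qed.

(** When the nearest representative is not on side [b], each factor of [l] opens a new coset and
    nothing collapses. The condition on [b'] says just this, and it reproduces itself for the next
    factor. *)
Let alt_word b l : @alt G A B b l -> exists2 u, cls R u = prodl l &
  forall o : Om, valid o -> (exists2 b' : bool, b' <> b \/ o.1 = [::] & normal_seq b' o.1) ->
   (size (foldl step o u : Om).1 = size o.1 + size l)%N.
Proof.
elim: l b => [|x l IH] b /=; first by exists [::] => // o _ _; rewrite addn0.
case=> -[sx nx] /IH[v Ev vP]; have [u Eu Xu] : exists2 u, cls R u = x & all (fun a => X b a.1) u.
  by case: {+}b sx => -[u Eu Xu]; exists u.
exists (u ++ v); first by rewrite cls_cat Eu Ev.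
move=> [l' c] vo [b' bb' nl']; rewrite foldl_cat (foldl_step vo Xu) Eu.
have Cc : C c by case: vo.
have E : split_at b (l', c) = (l', c).
  rewrite /split_at /=; case: l' bb' nl' {vo} => [//|y l'] [] // bb' [[_ ny] _ _].
  by case: asboolP => // sy; case: ny; have -> : ~~ b' = b by case: {+}b {+}b' bb' => [] [].
have ncx : ~ C (c * x).
  move=> Ccx; apply: nx; apply: C_side; have := CM (CV Cc) Ccx; by rewrite mulKg.
have E' : mact b (l', c) x = (tau (c * x) :: l', (tau (c * x))^-1 * (c * x)).
  by rewrite /mact E /join /=; case: asboolP.
rewrite vP.
- by rewrite E' /= addSnnS.
- exact: mact_valid.
- rewrite E' /=; exists b; first by left; case: {+}b.
  split; [|exact: tauK|]; first by apply: off_tau => //; apply: sideM => //; exact: C_side.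
  case: l' bb' nl' {E E' vo} => // y l' [] // bb' nl'.
  by have -> : ~~ b = b' by case: {+}b {+}b' bb' => [] [].
Qed.

Lemma amalgam_alt_neq1 b l : @alt G A B b l -> l <> [::] -> prodl l <> 1.
Proof.
move=> al nl E; have [u Eu uP] := alt_word al.
have vo : valid ([::], 1) by split=> //; exists true.
have u1 : pres_eq R u [::] by apply/clsP; rewrite Eu E.
have := uP _ vo; rewrite (stepP u1 vo) => /(_ (ex_intro2 _ _ true (or_intror erefl) I)).
by case: l nl {al E uP Eu}.
Qed.

Lemma amalgam_gen_side (P : G -> Prop) : P 1 ->
  (forall b x y, sd b x -> P y -> P (x * y)) -> forall x, P x.
Proof.
move=> P1 PM x; have := sub_full x; move: x; apply: sub_ind => // a x _ Px.
by apply: (PM (XA a.1)) => //; exact/side_lval/X_own.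
Qed.

End AmalgamNormalForm.

(** * Roots of the reflection representation *)

Local Open Scope ring_scope.

Section Reflections.
Variables (S : finType) (com br : rel S).
Hypotheses (comC : symmetric com) (brC : symmetric br).
Hypotheses (com_irr : irreflexive com) (br_irr : irreflexive br).
Hypothesis com_br : forall s t, com s t -> ~~ br s t.

(* Twice the cosine form of the Coxeter matrix with entries 2 on [com],
   3 on [br] and infinity elsewhere. *)
Definition bil (s t : S) : int :=
  if s == t then 2 else if com s t then 0 else if br s t then -1 else -2.

Lemma bilC s t : bil s t = bil t s.
Proof. by rewrite /bil eq_sym comC brC. Qed.
Lemma bil_diag s : bil s s = 2. Proof. by rewrite /bil eqxx. Qed.
Lemma bil_com s t : (bil s t == 0) = com s t.
Proof.
rewrite /bil; case: (eqVneq s t) => [->|_]; first by rewrite com_irr.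
by case: (com s t) => //; case: (br s t).
Qed.
Lemma bil_br s t : (bil s t == -1) = br s t.
Proof.
rewrite /bil; case: (eqVneq s t) => [->|_]; first by rewrite br_irr.
by case: (boolP (com s t)) => [/com_br/negbTE->|_] //; case: (br s t).
Qed.

Definition vec := {ffun S -> int}.
Definition alpha (s : S) : vec := [ffun t => (t == s)%:R].
Definition coef s (v : vec) : int := \sum_t bil s t * v t.
Definition lin (a : int) (u : vec) (b : int) (v : vec) : vec :=
  [ffun t => a * u t + b * v t].
Definition refl s (v : vec) : vec := lin 1 v (- coef s v) (alpha s).
Definition act (u : seq S) (v : vec) : vec := foldr refl v u.
Definition pos (v : vec) := forall t, 0 <= v t.

Lemma coef_lin s a u b v : coef s (lin a u b v) = a * coef s u + b * coef s v.
Proof.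
rewrite /coef !mulr_sumr -big_split; apply: eq_bigr => t _ /=.
by rewrite ffunE; ring.
Qed.
Lemma coef_alpha s t : coef s (alpha t) = bil s t.
Proof.
rewrite /coef (bigD1 t) //= ffunE eqxx mulr1 big1 ?addr0 // => x xt.
by rewrite ffunE (negbTE xt) mulr0.
Qed.
Lemma coef_refl s t v : coef s (refl t v) = coef s v - coef t v * bil s t.
Proof. by rewrite coef_lin coef_alpha; ring. Qed.
Lemma reflE s v t : refl s v t = v t - coef s v * (t == s)%:R.
Proof. by rewrite !ffunE; ring. Qed.

Lemma refl_lin s a u b v : refl s (lin a u b v) = lin a (refl s u) b (refl s v).
Proof. by apply/ffunP => t; rewrite !ffunE coef_lin; ring. Qed.
Lemma act_lin w a u b v : act w (lin a u b v) = lin a (act w u) b (act w v).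
Proof. by elim: w => //= s w ->; exact: refl_lin. Qed.

Lemma reflK s : involutive (refl s).
Proof. by move=> v; apply/ffunP => t; rewrite !reflE coef_refl bil_diag; ring. Qed.
Lemma refl_alpha s t : refl s (alpha t) = lin 1 (alpha t) (- bil s t) (alpha s).
Proof. by rewrite /refl coef_alpha. Qed.
Lemma refl_alphas s v : v = alpha s -> refl s v = lin (-1) (alpha s) 0 (alpha s).
Proof.
by move=> ->; rewrite refl_alpha bil_diag; apply/ffunP => t; rewrite !ffunE; ring.
Qed.

Lemma refl_com s t v : com s t -> refl s (refl t v) = refl t (refl s v).
Proof.
move=> st; have /eqP b0 : bil s t == 0 by rewrite bil_com.
apply/ffunP => x; rewrite !reflE !coef_refl (bilC t s) b0; ring.
Qed.
Lemma refl_braid s t v : br s t ->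
  refl s (refl t (refl s v)) = refl t (refl s (refl t v)).
Proof.
move=> st; have /eqP b1 : bil s t == -1 by rewrite bil_br.
apply/ffunP => x; rewrite !reflE !coef_refl !bil_diag (bilC t s) b1; ring.
Qed.

Lemma act_cat u v x : act (u ++ v) x = act u (act v x).
Proof. by rewrite /act foldr_cat. Qed.
Lemma act_rcons u s x : act (rcons u s) x = act u (refl s x).
Proof. by rewrite -cats1 act_cat. Qed.
Lemma actK u v : act (rev u) (act u v) = v.
Proof.
elim: u v => //= s u IH v; by rewrite rev_cons act_rcons reflK IH.
Qed.
Lemma actVK u v : act u (act (rev u) v) = v.
Proof. by rewrite -{1}(revK u) actK. Qed.

Definition form (u v : vec) : int := \sum_s u s * coef s v.
Lemma form_linl a u b v w : form (lin a u b v) w = a * form u w + b * form v w.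
Proof.
rewrite /form !mulr_sumr -big_split; apply: eq_bigr => t _ /=; rewrite ffunE; ring.
Qed.
Lemma form_alpha s v : form (alpha s) v = coef s v.
Proof.
rewrite /form (bigD1 s) //= ffunE eqxx mul1r big1 ?addr0 // => x xs.
by rewrite ffunE (negbTE xs) mul0r.
Qed.
Lemma formC u v : form u v = form v u.
Proof.
rewrite /form /coef; under eq_bigr do rewrite mulr_sumr.
rewrite exchange_big; apply: eq_bigr => t _ /=; rewrite mulr_sumr.
by apply: eq_bigr => s _; rewrite (bilC s t); ring.
Qed.
Lemma form_refl s u v : form (refl s u) (refl s v) = form u v.
Proof.
rewrite form_linl form_alpha coef_refl bil_diag formC form_linl form_alpha (formC v u).
ring.
Qed.
Lemma form_act w u v : form (act w u) (act w v) = form u v.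
Proof. by elim: w => //= s w; rewrite form_refl. Qed.
Lemma bil_act w s t x y : act w (alpha s) = alpha x -> act w (alpha t) = alpha y ->
  bil x y = bil s t.
Proof. by move=> sx ty; rewrite -!coef_alpha -!form_alpha -sx -ty form_act. Qed.

Lemma act_coef w s t : s \notin w -> act w (alpha t) s = (s == t)%:R.
Proof.
elim: w => [|x w IH] /=; first by rewrite ffunE.
by rewrite inE negb_or reflE => /andP[/negbTE-> /IH->]; rewrite mulr0 subr0.
Qed.

(* The alternating word of length [k] in [s] and [t] ending in [t]. *)
Fixpoint dih k (s t : S) : seq S := if k is k'.+1 then rcons (dih k' t s) t else [::].

Lemma size_dih k s t : size (dih k s t) = k.
Proof. by elim: k s t => //= k IH s t; rewrite size_rcons IH. Qed.
Lemma dih_cons k s t : dih k.+1 s t = (if odd k then s else t) :: dih k s t.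
Proof.
elim: k s t => //= k IH s t; rewrite -rcons_cons; congr rcons.
by move: (IH t s) => /= ->; case: (odd k).
Qed.

(** With [bil s t = -2] the reflection in [t] replaces the coefficient [b] of [t] by [2 a - b],
    which is at least [a]; the inequality thus persists with [s] and [t] exchanged. *)
Lemma act_dih k s t a b : bil s t = -2 -> 0 <= b -> b <= a ->
  exists p q, [/\ 0 <= p, 0 <= q & act (dih k s t) (lin a (alpha s) b (alpha t)) = lin p (alpha s) q (alpha t)].
Proof.
move=> st; elim: k s t a b st => [|k IH] s t a b st b0 ba.
  by exists a, b; split=> //; lia.
have := IH t s (2 * a - b) a; rewrite bilC => /(_ st) [||p [q [p0 q0 E]]]; [lia|lia|].
exists q, p; split=> //=; rewrite act_rcons.
have -> : refl t (lin a (alpha s) b (alpha t)) = lin (2 * a - b) (alpha t) a (alpha s).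
  rewrite refl_lin !refl_alpha (bilC t s) st bil_diag.
  by apply/ffunP => x; rewrite !ffunE; ring.
by rewrite E; apply/ffunP => x; rewrite !ffunE; ring.
Qed.

Lemma pos_lin a u b v : 0 <= a -> 0 <= b -> pos u -> pos v -> pos (lin a u b v).
Proof. by move=> a0 b0 pu pv t; rewrite ffunE addr_ge0 // mulr_ge0. Qed.
Lemma pos_alpha s : pos (alpha s).
Proof. by move=> t; rewrite ffunE ler0n. Qed.

(** The congruence is abstract because two are used: equality of the actions, for the signs of
    roots, and a joint equality in a target group and in S_n, for Coxeter's presentation. *)
Variable E : seq S -> seq S -> Prop.
Hypotheses (Erefl : forall u, E u u) (Esym : forall u v, E u v -> E v u)
  (Etrans : forall u v w, E u v -> E v w -> E u w)
  (Ecat : forall u v w, E u v -> E (u ++ w) (v ++ w))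
  (Esq : forall u s, E (u ++ [:: s; s]) u)
  (Ecom : forall u s t, com s t -> E (u ++ [:: s; t]) (u ++ [:: t; s]))
  (Ebr : forall u s t, br s t -> E (u ++ [:: s; t; s]) (u ++ [:: t; s; t]))
  (Eact : forall u v, E u v -> act u =1 act v).

Definition reduced u := forall v, E u v -> (size u <= size v)%N.
(** The inequality of lengths is weak, so its negation directly provides a strictly shorter word and
    the parity of lengths never enters. *)
Definition up u s := forall v, E (rcons u s) v -> (size u <= size v)%N.

Lemma reduce u : exists2 v, E u v & reduced v.
Proof.
have ex : exists n, `[< exists2 v, E u v & size v = n >].
  by exists (size u); apply/asboolP; exists u.
case: (ex_minnP ex) => n /asboolP[v uv <-] nmin; exists v => // w vw.
by apply: nmin; apply/asboolP; exists w => //; exact: Etrans vw.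
Qed.

Lemma Ercons u v s : E u v -> E (rcons u s) (rcons v s).
Proof. by rewrite -!cats1; exact: Ecat. Qed.
Lemma Ercons2 u s : E (rcons (rcons u s) s) u.
Proof. by rewrite -!cats1 -catA; exact: Esq. Qed.

(** Among the factorizations of [u] into some [w] and an alternating word in [s] and [t], lengths
    adding up, the one with the longest alternating part is taken. Then neither [w s] nor [w t] is
    shorter than [w], so induction makes both simple roots positive under [w], and a computation in
    rank two remains. *)
Lemma up_pos u s : reduced u -> up u s -> pos (act u (alpha s)).
Proof.
have [n] := ubnP (size u); elim: n u s => // n IH u s szu ru us.
case/lastP: u => [|u t] in szu ru us *; first exact: pos_alpha.
have ts : t <> s.
  move=> ts; have := us u; rewrite -ts size_rcons => /(_ (Ercons2 u t)); lia.
pose P k := exists w, [/\ E (rcons u t) (w ++ dih k s t) & (size w + k = (size u).+1)%N].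
have P1 : P 1%N by exists u; split=> /=; [rewrite cats1; exact: Erefl|rewrite addn1].
have exP : exists k, `[< P k >] by exists 1%N; apply/asboolP.
have bound k : `[< P k >] -> (k <= (size u).+1)%N.
  by move=> /asboolP[w [_]]; lia.
case: (ex_maxnP exP bound) => k /asboolP[w [Ew sw]] kmax.
have k1 : (0 < k)%N by apply: (kmax 1%N); apply/asboolP.
have szut : size (rcons u t) = (size u).+1 by rewrite size_rcons.
have shorter v : E (rcons u t) v -> ((size u).+1 <= size v)%N.
  by move=> /ru; rewrite szut.
have rw : reduced w.
  move=> v wv; have := shorter (v ++ dih k s t) (Etrans Ew (Ecat _ wv)).
  by rewrite size_cat size_dih; lia.
(* If [x] is the first letter of the alternating part, a shorter word for [w x] would shorten [u];
   if it is the other letter, it could be prepended to that part, against the maximality of [k]. *)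
have upw x : x = s \/ x = t -> up w x.
  move=> xst v wxv; rewrite leqNgt; apply/negP => vw.
  case: (eqVneq x (if odd k then t else s)) => xd.
    case: k k1 Ew sw kmax xd {rw} => // k _ Ew sw kmax xd.
    have := shorter (v ++ dih k s t); rewrite size_cat size_dih => H.
    suff /H : E (rcons u t) (v ++ dih k s t) by lia.
    apply: Etrans Ew _; rewrite dih_cons.
    have -> : (if odd k then s else t) = x by rewrite xd /=; case: (odd k).
    by rewrite -cat_rcons; exact: Ecat.
  have xd' : x = if odd k then s else t.
    by case: xst xd => ->; case: (odd k); rewrite ?eqxx.
  have wv : E w (rcons v x).
    by apply: Etrans (Esym (Ercons2 w x)) _; exact: Ercons.
  have sv : size v = (size w).-1.
    by have := rw _ wv; rewrite size_rcons; lia.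
  have : (k.+1 <= k)%N; last by lia.
  apply: kmax; apply/asboolP; exists v; split; last by lia.
  by apply: Etrans Ew _; rewrite dih_cons -xd' -cat_rcons; exact: Ecat.
have ps : pos (act w (alpha s)) by apply: IH; [lia | | apply: upw; left].
have pt : pos (act w (alpha t)) by apply: IH; [lia | | apply: upw; right].
rewrite (Eact Ew) act_cat.
suff [p [q [p0 q0 ->]]] : exists p q, [/\ 0 <= p, 0 <= q &
    act (dih k s t) (alpha s) = lin p (alpha s) q (alpha t)].
  by rewrite act_lin; exact: pos_lin.
have down v : E (rcons (rcons u t) s) v -> ((size u).+1 <= size v)%N.
  by move=> /us; rewrite szut.
have Ews : E (rcons (rcons u t) s) (w ++ rcons (dih k s t) s).
  by rewrite -rcons_cat; exact: Ercons.
have bst : bil s t = if com s t then 0 else if br s t then -1 else -2.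
  by rewrite /bil; case: eqP => // st; case: ts.
(* For a finite label m (2, then 3), [k >= m] would allow a commutation or braid move that cancels
   the final [s], against [up]; only [k < m] is left to compute. *)
case: (boolP (com s t)) bst => [cst|_] bst.
  case: k k1 Ew sw Ews {kmax upw} => // -[|k] _ Ew sw Ews.
    exists 1, 0; split=> //=; rewrite refl_alpha bilC bst.
    by apply/ffunP => x; rewrite !ffunE; ring.
  have /down : E (rcons (rcons u t) s) (w ++ rcons (dih k s t) t).
    apply: Etrans Ews _; rewrite /= -!cats1 -!catA /= !catA.
    have cst' : com t s by rewrite comC.
    apply: Etrans (_ : E ((w ++ dih k s t) ++ [:: t; s; s]) _).
      by have := Ecat [:: s] (Ecom (w ++ dih k s t) cst); rewrite -!catA.
    by have := Esq ((w ++ dih k s t) ++ [:: t]) s; rewrite -!catA.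
  by rewrite size_cat size_rcons size_dih; lia.
case: (boolP (br s t)) bst => [bs|_] bst.
  case: k k1 Ew sw Ews {kmax upw} => // -[|[|k]] _ Ew sw Ews.
  - exists 1, 1; split=> //=; rewrite refl_alpha bilC bst.
    by apply/ffunP => x; rewrite !ffunE; ring.
  - exists 0, 1; split=> //=; rewrite refl_alpha bilC bst refl_lin !refl_alpha bst bil_diag.
    by apply/ffunP => x; rewrite !ffunE; ring.
  have /down : E (rcons (rcons u t) s) (w ++ rcons (rcons (dih k t s) s) t).
    apply: Etrans Ews _; rewrite /= -!cats1 -!catA /= !catA.
    apply: Etrans (_ : E ((w ++ dih k t s) ++ [:: s; t; s; s]) _).
      have bs' : br t s by rewrite brC.
      by have := Ecat [:: s] (Ebr (w ++ dih k t s) bs'); rewrite -!catA.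
    by have := Esq ((w ++ dih k t s) ++ [:: s; t]) s; rewrite -!catA.
  by rewrite size_cat !size_rcons size_dih; lia.
have [||p [q [p0 q0 pqE]]] := @act_dih k s t 1 0 bst; [lia|lia|].
exists p, q; split=> //; rewrite -pqE; congr act.
by apply/ffunP => x; rewrite !ffunE; ring.
Qed.

Lemma not_up u s : reduced u -> ~ up u s ->
  exists v, [/\ E (rcons v s) u, reduced v, up v s & (size v < size u)%N].
Proof.
move=> ru nup; have [v' [vE vlt]] : exists v', E (rcons u s) v' /\ (size v' < size u)%N.
  apply: contrapT => h; apply: nup => v' vE; rewrite leqNgt; apply/negP => vlt.
  by apply: h; exists v'.
have [v v'v rv] := reduce v'; have vs : E (rcons v s) u.
  by apply: Etrans (Ercons2 u s); apply: Ercons; apply: Esym; exact: Etrans vE v'v.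
have vv' : (size v <= size v')%N by exact: rv (Esym v'v).
exists v; split=> //; last by lia.
by move=> w vsw; have := ru w (Etrans (Esym vs) vsw); lia.
Qed.

Lemma root_sign_of u s : pos (act u (alpha s)) \/ pos (lin (-1) (act u (alpha s)) 0 (alpha s)).
Proof.
have [v uv rv] := reduce u; rewrite (Eact uv).
have [vs|nvs] := pselect (up v s); first by left; exact: up_pos.
right; have [w [/Eact wE rw ws _]] := not_up rv nvs.
rewrite -wE act_rcons (refl_alphas erefl) act_lin.
have -> : lin (-1) (lin (-1) (act w (alpha s)) 0 (act w (alpha s))) 0 (alpha s) = act w (alpha s).
  by apply/ffunP => x; rewrite !ffunE; ring.
exact: up_pos.
Qed.

(** The last letter of a non-empty reduced word is a descent, so the word makes that simple root
    negative, which the identity does not. *)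
Lemma act_faithful_of u : act u =1 id -> E u [::].
Proof.
move=> uid; have [v uv rv] := reduce u.
have vid : act v =1 id by move=> x; rewrite -(Eact uv).
apply: Etrans uv _; case/lastP: v => [|v s] in rv vid *; first exact: Erefl.
have nup : ~ up (rcons v s) s by move=> /(_ v (Ercons2 v s)); rewrite size_rcons ltnn.
have [w [/Eact wE rw ws _]] := not_up rv nup; have := up_pos rw ws => /(_ s).
move: (wE (alpha s)); rewrite vid act_rcons (refl_alphas erefl) act_lin => /ffunP/(_ s).
by rewrite !ffunE eqxx /=; lia.
Qed.

End Reflections.

(** * Artin and right-angled Coxeter groups *)

Section GraphGroup.
Variables (S : finType) (com br : rel S).
Hypotheses (comC : symmetric com) (brC : symmetric br).
Hypotheses (com_irr : irreflexive com) (br_irr : irreflexive br).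
Hypothesis com_br : forall s t, com s t -> ~~ br s t.
Variable eps : bool.

Let pl (s : S) : letter S := (s, false).

(* The Artin group of the labelled graph [(com, br)], or the Coxeter group
   when [eps] holds. *)
Inductive gg_rel : word S -> word S -> Prop :=
| gg_com s t of com s t : gg_rel [:: pl s; pl t] [:: pl t; pl s]
| gg_br s t of br s t : gg_rel [:: pl s; pl t; pl s] [:: pl t; pl s; pl t]
| gg_sq s of eps : gg_rel [:: pl s; pl s] [::].

Local Notation G := (gp gg_rel).
Local Notation gen := (@gen S gg_rel).
Local Notation bil := (bil com br).
Local Notation refl := (refl com br).
Local Notation act := (act com br).
Let bilC := bilC comC brC.
Let bil_com := bil_com br com_irr.
Let bil_br := bil_br br_irr com_br.
Let refl_com s t v := @refl_com _ _ _ comC brC com_irr s t v.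
Let refl_braid s t v := @refl_braid _ _ _ comC brC br_irr com_br s t v.
Let actK := @actK S com br.

Lemma gen_com s t : com s t -> (gen s * gen t = gen t * gen s)%g.
Proof.
by move=> st; have := cls_rel (gg_com st); rewrite !cls_cons cls0 !mulg1.
Qed.
Lemma gen_br s t : br s t ->
  (gen s * (gen t * gen s) = gen t * (gen s * gen t))%g.
Proof.
by move=> st; have := cls_rel (gg_br st); rewrite !cls_cons cls0 !mulg1.
Qed.
Lemma gen_sq s : eps -> (gen s * gen s = 1)%g.
Proof.
by move=> e; have := cls_rel (gg_sq s e); rewrite !cls_cons cls0 !mulg1.
Qed.

Lemma root_sign u s :
  pos (act u (alpha s)) \/ pos (lin (-1) (act u (alpha s)) 0 (alpha s)).
Proof.
apply: (root_sign_of comC brC (E := fun u v => act u =1 act v)) => //.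
- by move=> ? ? uv x; rewrite uv.
- by move=> ? ? ? uv vw x; rewrite uv.
- by move=> ? ? w uv x; rewrite !act_cat uv.
- by move=> ? ? x; rewrite act_cat /= reflK.
- by move=> ? ? ? h x; rewrite !act_cat /= refl_com.
- by move=> ? ? ? h x; rewrite !act_cat /= refl_braid.
Qed.

Lemma alpha_inj : injective (@alpha S).
Proof.
move=> s t /ffunP/(_ s); rewrite !ffunE eqxx; by case: eqP.
Qed.

(** A simple reflection alters only the coefficient at [s], so a positive root that it makes
    negative is a multiple of [alpha s]. Applying the inverse of [u] shows the factor to divide the
    coefficient 1 of [alpha t], hence to be 1. *)
Lemma refl_pos s u t : pos (act u (alpha t)) -> act u (alpha t) <> alpha s ->
  pos (refl s (act u (alpha t))).
Proof.
set b := act u (alpha t) => pb nb.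
case: (root_sign (s :: u) t) => //= nn.
have b0 x : x != s -> b x = 0.
  move=> xs; have := nn x; have := pb x; rewrite ffunE reflE (negbTE xs) -/b ffunE; lia.
have bE : b = lin (b s) (alpha s) 0 (alpha s).
  apply/ffunP => x; rewrite !ffunE; case: (eqVneq x s) => [->|xs]; first by rewrite mulr1 mul0r addr0.
  by rewrite b0 // !mulr0 addr0.
have := actK u (alpha t); rewrite -/b bE act_lin => /ffunP/(_ t).
rewrite !ffunE eqxx mul0r addr0 /=; set k : int := act _ _ _ => H.
have bs1 : b s = 1.
  have := pb s; have /(congr1 absz)/eqP : b s * k = 1 by [].
  by rewrite abszM muln_eq1 => /andP[/eqP b1 _]; lia.
case: nb; rewrite bE bs1.
by apply/ffunP => x; rewrite !ffunE; ring.
Qed.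

Lemma pres_eq_act u v : pres_eq gg_rel u v ->
  act [seq a.1 | a <- u] =1 act [seq a.1 | a <- v].
Proof.
pose f (w : vec S -> vec S) (a : letter S) := w \o refl a.1.
have fE u' w : foldl f w u' = w \o act [seq a.1 | a <- u'].
  elim: u' w => [|a u' IH] w /=; first by apply: funext.
  by rewrite IH; apply: funext.
move=> uv; have := pres_eq_foldl (f := f) (inv := fun=> True) _ _ _ uv (o := id).
rewrite !fE => H x; suff /(congr1 (fun h => h x)) : id \o act [seq a.1 | a <- u] = id \o act [seq a.1 | a <- v] by [].
apply: H => // [w a _|w l r _ lr]; apply: funext => y; first by rewrite /f /= reflK.
case: lr => [s t h|s t h|s _]; rewrite /f /=.
- by congr w; exact: refl_com.
- by congr w; exact: refl_braid.
- by rewrite reflK.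
Qed.

(** Serves as a test for not belonging to a standard parabolic subgroup: reflections in [X] leave
    the coefficients outside [X] alone. *)
Lemma sub_coef (X : pred S) u s t : sub X (cls gg_rel u) -> ~~ X s ->
  act [seq a.1 | a <- u] (alpha t) s = (s == t)%:R.
Proof.
case=> v /clsP/pres_eq_act vu Xv nXs; rewrite -vu act_coef //.
by apply/mapP => -[a av E]; move/allP/(_ _ av): Xv; rewrite -E (negbTE nXs).
Qed.

(** * The Charney-Paris retraction, as a machine reading words *)

Section Retraction.
Variable X : pred S.

(** As w s w^-1 is the reflection in the root w(alpha s), a label [x] of that root means w s = x w:
    the letter [s] fixes the coset of [w]. *)
Let lab (v : vec S) : option S := [pick x | X x && (v == alpha x)].

Variant lab_spec v : option S -> Prop :=
| LabSome x of X x & v = alpha x : lab_spec v (Some x)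
| LabNone of (forall x, X x -> v <> alpha x) : lab_spec v None.

Let labP v : lab_spec v (lab v).
Proof.
rewrite /lab; case: pickP => [x /andP[Xx /eqP]|h]; first exact: LabSome.
by apply: LabNone => x Xx /eqP vx; move: (h x); rewrite Xx vx.
Qed.

Let lab_alpha x : X x -> lab (alpha x) = Some x.
Proof.
by move=> Xx; case: labP => [y _ /alpha_inj->//|/(_ x Xx)].
Qed.
Let lab_none v : (forall x, X x -> v <> alpha x) -> lab v = None.
Proof. by move=> h; case: labP => // x Xx /(h x Xx). Qed.

Let Om := (G * (vec S -> vec S))%type.

(* Reads a word letter by letter, [o.2] being the current coset representative:
   a letter [s] that fixes the coset contributes the conjugate of [s] by the
   representative, which is then a generator in [X]. *)
Let step (o : Om) (a : letter S) : Om :=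
  if lab (o.2 (alpha a.1)) is Some x then ((o.1 * lval gg_rel (x, a.2))%g, o.2)
  else (o.1, o.2 \o refl a.1).

Let stepS g w a x : lab (w (alpha a.1)) = Some x ->
  step (g, w) a = ((g * lval gg_rel (x, a.2))%g, w).
Proof. by rewrite /step /= => ->. Qed.
Let stepN g w a : lab (w (alpha a.1)) = None ->
  step (g, w) a = (g, w \o refl a.1).
Proof. by rewrite /step /= => ->. Qed.

(* [w] is the shortest element of its coset of the standard parabolic
   subgroup of the Coxeter group generated by [X]. *)
Let minimal (w : vec S -> vec S) :=
  exists2 u, w = act u & forall x, X x -> pos (act (rev u) (alpha x)).

Let minimal_refl w s : minimal w -> lab (w (alpha s)) = None ->
  minimal (w \o refl s).
Proof.
case=> u -> pu; case: labP => // nx _; exists (rcons u s).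
  by apply: funext => x /=; rewrite act_rcons.
move=> x Xx; rewrite rev_rcons /=; apply: refl_pos; first exact: pu.
by move=> E; apply: (nx x Xx); rewrite -E actVK.
Qed.

(** After a move from [w] to [w s], reading [s] or its inverse must move back. It does, since
    w^-1(alpha x) is positive and so never equals the negative of [alpha s]. *)
Let lab_neg w s : minimal w -> lab (w (refl s (alpha s))) = None.
Proof.
case=> u -> pu; apply: lab_none => x Xx E; have := pu x Xx s.
by rewrite -E actK (refl_alphas _ _ erefl) !ffunE eqxx; lia.
Qed.

Let step_minimal o a : minimal o.2 -> minimal (step o a).2.
Proof.
move=> mo; rewrite /step; case E : (lab _) => [x|] //=; exact: minimal_refl.
Qed.

Let stepK o a : minimal o.2 -> step (step o a) (lflip a) = o.
Proof.
case: o => g w /= mo; case E : (lab (w (alpha a.1))) => [x|].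
  rewrite (stepS g E) (@stepS _ _ _ x) //=.
  by rewrite -mulgA -[(x, ~~ a.2)]/(lflip (x, a.2)) lval_flip mulgV mulg1.
rewrite (stepN g E) stepN /=; last exact: lab_neg.
by congr pair; apply: funext => v /=; rewrite reflK.
Qed.

Let step_com g w s t : com s t -> minimal w ->
  step (step (g, w) (pl s)) (pl t) = step (step (g, w) (pl t)) (pl s).
Proof.
move=> st mw; have [u uE _] := mw.
have b0 : bil s t = 0 by apply/eqP; rewrite bil_com.
have fix_ x y : bil x y = 0 -> refl x (alpha y) = alpha y.
  by move=> b; rewrite refl_alpha b; apply/ffunP => z; rewrite !ffunE; ring.
have fst_ := fix_ _ _ b0; have fts : refl t (alpha s) = alpha s by apply: fix_; rewrite bilC.
case Es : (lab (w (alpha s))) => [x|]; case Et : (lab (w (alpha t))) => [y|].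
- rewrite !(fun g' => @stepS g' w (pl s) x Es, fun g' => @stepS g' w (pl t) y Et) /=.
  move: Es Et; case: labP => // x' Xx wx [<-]; case: labP => // y' Xy wy [<-].
  congr pair; rewrite -!mulgA; congr (_ * _)%g; apply: gen_com.
  rewrite -bil_com.
  by rewrite uE in wx wy; rewrite (bil_act comC brC wx wy) b0.
- rewrite (@stepS _ _ (pl s) _ Es) !(@stepN _ _ (pl t) Et).
  by rewrite (@stepS _ _ _ x) //= fts.
- rewrite (@stepS _ _ (pl t) _ Et) !(@stepN _ _ (pl s) Es).
  by rewrite (@stepS _ _ _ y) //= fst_.
rewrite (@stepN _ _ (pl s) Es) !(@stepN _ _ (pl t) Et).
rewrite !stepN /= ?fts ?fst_ //.
by congr pair; apply: funext => v /=; rewrite refl_com.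
Qed.

Let step_br g w s t : br s t -> minimal w ->
  step (step (step (g, w) (pl s)) (pl t)) (pl s) =
  step (step (step (g, w) (pl t)) (pl s)) (pl t).
Proof.
move=> st mw; have [u uE _] := mw.
have b1 : bil s t = -1 by apply/eqP; rewrite bil_br.
have b1' : bil t s = -1 by rewrite bilC.
pose c := lin 1 (alpha s) 1 (alpha t) : vec S.
have st_ : refl s (alpha t) = c.
  by rewrite refl_alpha b1; apply/ffunP => z; rewrite !ffunE; ring.
have ts_ : refl t (alpha s) = c.
  by rewrite refl_alpha b1'; apply/ffunP => z; rewrite !ffunE; ring.
have sc : refl s c = alpha t by rewrite -st_ reflK.
have tc : refl t c = alpha s by rewrite -ts_ reflK.
have wc : w c = lin 1 (w (alpha s)) 1 (w (alpha t)) by rewrite uE act_lin.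
(* A root is non-zero with coefficients of one sign, so a difference of simple roots is not a root.
   Hence if exactly one of [s], [t] has a label, their sum [c] has none. *)
have diff x z r : act u (alpha r) <> lin 1 (alpha z) (-1) (alpha x).
  move=> E; case: (eqVneq z x) => [zx|zx].
    have := actK u (alpha r); rewrite E zx act_lin => /ffunP/(_ r).
    rewrite !ffunE eqxx; set k : int := act _ _ _; lia.
  have xz : (x == z) = false by rewrite eq_sym (negbTE zx).
  by have := root_sign u r; rewrite E => -[/(_ x)|/(_ z)];
    rewrite !ffunE !eqxx ?(negbTE zx) ?xz; lia.
case Es : (lab (w (alpha s))) => [x|]; case Et : (lab (w (alpha t))) => [y|].
- rewrite !(fun g' => @stepS g' w (pl s) x Es, fun g' => @stepS g' w (pl t) y Et) /=.
  move: Es Et; case: labP => // x' Xx wx [<-]; case: labP => // y' Xy wy [<-].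
  congr pair; rewrite -!mulgA; congr (_ * _)%g; apply: gen_br.
  rewrite -bil_br.
  by rewrite uE in wx wy; rewrite (bil_act comC brC wx wy) b1.
- have Ec : lab (w c) = None.
    move: Es; case: labP => // x' Xx wx _; apply: lab_none => z Xz.
    rewrite wc wx => zE; apply: (diff x' z t); rewrite -uE -zE.
    by apply/ffunP => y; rewrite !ffunE; ring.
  rewrite (@stepS _ _ (pl s) _ Es) !(@stepN _ _ (pl t) Et).
  rewrite !(@stepN _ (w \o refl t) (pl s)) /= ?ts_ //.
  by rewrite (@stepS _ _ _ x) //= st_ tc.
- have Ec : lab (w c) = None.
    move: Et; case: labP => // x' Xx wx _; apply: lab_none => z Xz.
    rewrite wc wx => zE; apply: (diff x' z s); rewrite -uE -zE.
    by apply/ffunP => ?; rewrite !ffunE; ring.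
  rewrite (@stepS _ _ (pl t) _ Et) !(@stepN _ _ (pl s) Es).
  rewrite !(@stepN _ (w \o refl s) (pl t)) /= ?st_ //.
  by rewrite (@stepS _ _ _ y) //= ts_ sc.
rewrite !(@stepN _ _ (pl s) Es) !(@stepN _ _ (pl t) Et).
(* If only [c] has a label [z], both words leave [w], output [z] once and return to [w]. *)
case Ec : (lab (w c)) => [z|].
  rewrite (@stepS _ (w \o refl s) (pl t) z) ?(@stepS _ (w \o refl t) (pl s) z) /= ?st_ ?ts_ //.
  rewrite !stepN /=; try exact: lab_neg.
  by congr pair; apply: funext => v /=; rewrite !reflK.
rewrite (@stepN _ (w \o refl s) (pl t)) ?(@stepN _ (w \o refl t) (pl s)) /= ?st_ ?ts_ //.
rewrite (@stepN _ (w \o refl s \o refl t) (pl s)) ?(@stepN _ (w \o refl t \o refl s) (pl t)) /= ?st_ ?ts_ ?sc ?tc //.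
by congr pair; apply: funext => v /=; rewrite refl_braid.
Qed.

Let stepP u v : pres_eq gg_rel u v ->
  forall o, minimal o.2 -> foldl step o u = foldl step o v.
Proof.
apply: (pres_eq_foldl (f := step) (inv := fun o => minimal o.2)) => [o a|o a|[g w] l r mo lr].
- exact: step_minimal.
- exact: stepK.
case: lr => [s t st|s t st|s e] /=; [exact: step_com|exact: step_br|].
rewrite /step /=; case E : (lab (w (alpha s))) => [x|] /=.
  by rewrite E -mulgA gen_sq // mulg1.
by rewrite lab_neg //; congr pair; apply: funext => y /=; rewrite reflK.
Qed.

Let foldl_in u g : all (fun a => X a.1) u -> foldl step (g, id) u = (g * cls gg_rel u, id)%g.
Proof.
elim: u g => [|[s e] u IH] g /=; first by rewrite cls0 mulg1.
by move=> /andP[Xs Xu]; rewrite /step /= lab_alpha //= IH // cls_cons mulgA.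
Qed.

Let foldl_sub (Y : pred S) u g w : all (fun a => Y a.1) u -> all Y w ->
  exists h w', [/\ sub [predI X & Y] h, all Y w' & foldl step (g, act w) u = (g * h, act w')%g].
Proof.
elim: u g w => [|[s e] u IH] g w /=.
  by move=> _ Yw; exists 1%g, w; rewrite mulg1; split=> //; exact: sub1.
case/andP=> Ys Yu Yw; rewrite /step /=; case: labP => [x Xx wx|_] /=.
  have [h [w' [sh Yw' ->]]] := IH (g * lval gg_rel (x, e))%g w Yu Yw.
  exists (lval gg_rel (x, e) * h)%g, w'; rewrite mulgA; split=> //.
  apply: subM => //; apply: sub_lval; apply/andP; split=> //; change (is_true (Y x)).
  apply: contraT => Yx; have := act_coef com br (s := x) (w := w) s.
  rewrite wx ffunE eqxx; have xw : x \notin w by apply: contra Yx => /(allP Yw).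
  by move=> /(_ xw); case: eqP => // xs; move: Yx; rewrite xs Ys.
have -> : act w \o refl s = act (rcons w s) by apply: funext => v; rewrite act_rcons.
by apply: IH => //; rewrite all_rcons Ys.
Qed.

(** The retraction fixes every element of <X>. On a word in [Y] the representative [w] stays in the
    group generated by [Y], which cannot send [alpha s] with [s] in [Y] to a simple root outside
    [Y]; so all the output lies in the intersection of [X] and [Y]. *)
Lemma sub_capl (Y : pred S) g : sub X g -> sub Y g -> sub [predI X & Y] (g : G).
Proof.
move=> [u ug Xu] [v vg Yv]; have /stepP H : pres_eq gg_rel u v by apply/clsP; rewrite ug.
have m1 : minimal id.
  by exists [::]; [exact: funext | move=> x _; exact: pos_alpha].
have [h [w' [sh _]]] := @foldl_sub Y v 1%g [::] Yv isT.
have -> : act [::] = id by apply: funext.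
rewrite -(H (1%g, id) m1) foldl_in // !mul1g ug => -[-> _]; exact: sh.
Qed.

End Retraction.

(** The first partner [s] of [t] splits G as an amalgam; the second, [u], provides the element [t u]
    of <S \ s>. *)
Hypothesis inf : forall t, exists s u, [/\ s != u, bil t s = -2 & bil t u = -2].

Variable N : G -> Prop.
Hypotheses (NJ : forall x g : G, N x -> N (g^-1 * (x * g))%g)
           (Nab : forall x y : G, N x -> N y -> (x * y = y * x)%g).

Lemma abelian_normal_sub x t : N x -> sub (predC1 t) x.
Proof.
have [s [u [su ts tu]]] := inf t.
have nts : t != s by apply/eqP => E; move: ts; rewrite E bil_diag.
have ntu : t != u by apply/eqP => E; move: tu; rewrite E bil_diag.
have cover y : predC1 s y || predC1 t y.
  by rewrite /= -negb_and; apply/negP => /andP[/eqP-> /eqP E]; rewrite E eqxx in nts.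
have supp l r : gg_rel l r ->
    all (fun a => predC1 s a.1) (l ++ r) \/ all (fun a => predC1 t a.1) (l ++ r).
  have pair_ok a b : bil a b <> -2 -> (a != s) && (b != s) \/ (a != t) && (b != t).
    move=> ab; case: (eqVneq a s) => [as_|_]; case: (eqVneq b t) => [bt|_] /=; 
      rewrite ?andbT ?andbF.
    - by case: ab; rewrite as_ bt bilC.
    - by right; rewrite as_ eq_sym nts.
    - by left; rewrite bt nts.
    - case: (eqVneq b s) => [bs|_]; last by left.
      right; apply/eqP => at_; case: ab; by rewrite at_ bs.
  case=> [a b ab|a b ab|a _] /=.
  - have /pair_ok : bil a b <> -2 by move: ab; rewrite -bil_com => /eqP->.
    by case=> /andP[-> ->]; [left|right].
  - have /pair_ok : bil a b <> -2 by move: ab; rewrite -bil_br => /eqP->.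
    by case=> /andP[-> ->]; [left|right].
  - case: (eqVneq a s) => [->|_]; last by left.
    by right; rewrite eq_sym nts.
move=> Nx.
pose zz a b := lin a (alpha t) b (alpha u) : vec S.
(* On the plane of [alpha t] and [alpha u] the product [t u] sends (1,0) to (3,2), (5,4), (7,6). The
   coefficient at [t] is never 1 again, so [sub_coef] keeps the three powers out of <S \ t>. *)
have zzE a b : refl t (refl u (zz a b)) = zz (3 * a - 2 * b) (2 * a - b).
  apply/ffunP => y; rewrite /zz !reflE !coef_refl !coef_lin !coef_alpha.
  rewrite (bilC u t) tu !bil_diag !ffunE.
  by case: (y == t); case: (y == u) => /=; lia.
have zz_t a b : zz a b t = a by rewrite !ffunE eqxx (negbTE ntu) mulr1 mulr0 addr0.
have z1 : alpha t = zz 1 0 by apply/ffunP => y; rewrite !ffunE; ring.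
clearbody zz.
pose tuw := [:: pl t; pl u].
have notB w : act [seq a.1 | a <- w] (alpha t) t != 1 -> ~ sub (predC1 t) (cls gg_rel w).
  move=> /eqP h /sub_coef => /(_ t t); rewrite /= eqxx => /(_ isT) E; exact: h.
pose z : G := cls gg_rel tuw.
have [] := @abelian_normal_in_amalgam G (sub (predC1 s)) (sub (predC1 t))
  (sub_subgroup _ _) (sub_subgroup _ _) (amalgam_gen_side cover)
  (amalgam_alt_neq1 cover supp) N NJ Nab z (gen s) _ _ _ _ _ _ x Nx => //.
- by exists tuw => //=; rewrite nts eq_sym su.
- by apply: notB; rewrite /tuw /= z1 zzE zz_t.
- by rewrite -cls_cat; apply: notB; rewrite /tuw /= z1 !zzE zz_t.
- rewrite -(cls_cat _ tuw tuw) -(cls_cat _ tuw (tuw ++ tuw)).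
  by apply: notB; rewrite /tuw /= z1 !zzE zz_t.
- by apply: sub_gen; rewrite /= eq_sym.
- move=> /(@sub_coef _ _ s s); rewrite /= eqxx => /(_ isT).
  by rewrite (refl_alphas _ _ erefl) !ffunE eqxx.
Qed.

Theorem abelian_normal_trivial x : N x -> x = 1%g.
Proof.
move=> Nx; have H (l : seq S) : sub [pred y | y \notin l] x.
  elim: l => [|t l IH]; first by apply: subS (sub_full x).
  apply: subS (sub_capl (abelian_normal_sub t Nx) IH) => y /=.
  by rewrite inE negb_or.
by apply: sub_none; apply: subS (H (enum S)) => y /=; rewrite mem_enum.
Qed.

End GraphGroup.

(** * Coxeter's presentation of the symmetric group *)

Section AdjacentTranspositions.
Variable n : nat.
Local Notation I := 'I_n.-1.
Local Notation adj_transp := (@adj_transp n).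

Definition lo (i : I) : 'I_n := Ordinal (adj_lo_lt i).
Definition hi (i : I) : 'I_n := Ordinal (adj_hi_lt i).
Definition sprod (u : seq I) : 'S_n := foldr (fun i p => (adj_transp i * p)%g) 1%g u.

Lemma adj_transpE i : adj_transp i = tperm (lo i) (hi i). Proof. by []. Qed.
Lemma lo_hi i : lo i != hi i. Proof. by rewrite -val_eqE /=; lia. Qed.
Lemma adj_transp_lo i : adj_transp i (lo i) = hi i. Proof. exact: tpermL. Qed.
Lemma adj_transp_hi i : adj_transp i (hi i) = lo i. Proof. exact: tpermR. Qed.
Lemma adj_transp_id i x : x != lo i -> x != hi i -> adj_transp i x = x.
Proof. by rewrite ![x == _]eq_sym; exact: tpermD. Qed.
Lemma adj_transp2 i : (adj_transp i * adj_transp i = 1)%g. Proof. exact: tperm2. Qed.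
Lemma adj_transpV i : ((adj_transp i)^-1 = adj_transp i)%g. Proof. exact: tpermV. Qed.

Lemma sprod_cat u v : sprod (u ++ v) = (sprod u * sprod v)%g.
Proof. by elim: u => [|i u /= ->]; rewrite ?mul1g ?mulgA. Qed.
Lemma sprod_rev u : sprod (rev u) = (sprod u)^-1%g.
Proof.
elim: u => [|i u IH]; first by rewrite invg1.
by rewrite rev_cons -cats1 sprod_cat /= IH mulg1 invMg adj_transpV.
Qed.

Lemma sprod_fix k u (x : 'I_n) : all (fun i : I => k <= i)%N u -> (x < k)%N ->
  sprod u x = x.
Proof.
elim: u => [|i u IH] /=; first by rewrite perm1.
by case/andP=> ki ku xk; rewrite permM adj_transp_id ?IH // -val_eqE /=; lia.
Qed.

Lemma sprod_move k (j : 'I_n) (ko : 'I_n) : val ko = k -> (k <= j)%N ->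
  exists2 u, all (fun i : I => k <= i)%N u & sprod u j = ko.
Proof.
move=> kok; case: j => j; elim: j => [|j IH] jn /= kj.
  exists [::] => //=; rewrite perm1; apply: val_inj; rewrite /= kok; lia.
case: (eqVneq k j.+1) => [E|nk].
  by exists [::] => //=; rewrite perm1; apply: val_inj; rewrite /= kok.
have jn1 : (j < n.-1)%N by lia.
have [|u ku uE] := IH (ltnW jn); first by rewrite /=; lia.
exists (Ordinal jn1 :: u) => /=; first by rewrite ku andbT; lia.
rewrite permM; have -> : Ordinal jn = hi (Ordinal jn1) by exact: val_inj.
by rewrite adj_transp_hi -uE; congr (sprod u _); exact: val_inj.
Qed.

(** Used for [k = 0], where it is generation by adjacent transpositions, and for [k = 2], the
    stabilizer of the first two strands. *)
Lemma sprod_stab k (p : 'S_n) : (forall x : 'I_n, (x < k)%N -> p x = x) ->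
  exists2 u, all (fun i : I => k <= i)%N u & sprod u = p.
Proof.
have [m] := ubnP (n - k); elim: m k p => // m IH k p km fixp.
case: (leqP n k) => [nk|kn].
  exists [::] => //=; apply/permP => x; rewrite perm1 fixp //.
  exact: leq_trans (ltn_ord x) nk.
pose ko := Ordinal kn.
have kp : (k <= p ko)%N.
  rewrite leqNgt; apply/negP => h; have := fixp _ h => /perm_inj E.
  by move: h; rewrite E /= ltnn.
have [u ku uE] := sprod_move (ko := ko) erefl kp.
have [||w kw wE] := IH k.+1 (p * sprod u)%g; first by lia.
  move=> x; rewrite ltnS leq_eqVlt permM => /orP[/eqP xk|xk].
    by have -> : x = ko by exact: val_inj.
  by rewrite fixp // (sprod_fix ku).
exists (w ++ rev u); last by rewrite sprod_cat wE sprod_rev mulgK.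
rewrite all_cat all_rev ku andbT; apply: sub_all kw => i; exact: ltnW.
Qed.

Lemma sprod_surj p : exists u, sprod u = p.
Proof. by have [u _ uE] := @sprod_stab 0 p (fun x => ltac:(by [])); exists u. Qed.

Lemma perm_trans (T : finType) (s1 s2 : seq T) : size s1 = size s2 -> uniq s1 ->
  uniq s2 -> exists p : {perm T}, map p s1 = s2.
Proof.
elim: s1 s2 => [|x s1 IH] [|y s2] //=; first by exists 1%g.
case=> sz /andP[xs us1] /andP[ys us2]; have [p pE] := IH s2 sz us1 us2.
exists (p * tperm (p x) y)%g; rewrite permM tpermL; congr cons.
rewrite -pE; apply/eq_in_map => z zs; rewrite permM tpermD //.
  by apply: contra xs => /eqP/perm_inj->.
by apply: contra ys => /eqP ->; rewrite -pE map_f.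
Qed.

Definition farb (i j : I) : bool := (i.+1 < j)%N || (j.+1 < i)%N.
Definition nextb (i j : I) : bool := (j == i.+1 :> nat) || (i == j.+1 :> nat).

Lemma farb_sym : symmetric farb. Proof. by move=> i j; rewrite /farb orbC. Qed.
Lemma nextb_sym : symmetric nextb. Proof. by move=> i j; rewrite /nextb orbC. Qed.
(* The embedding of the root lattice into Z^n, alpha_i being sent to
   e_i - e_(i+1). *)
Definition emb (v : vec I) (k : 'I_n) : int :=
  \sum_i v i * ((k == lo i)%:R - (k == hi i)%:R).

Lemma emb_lin a u b v k : emb (lin a u b v) k = a * emb u k + b * emb v k.
Proof.
rewrite /emb !mulr_sumr -big_split; apply: eq_bigr => i _ /=; rewrite ffunE.
by set c : int := _ - _; ring.
Qed.
Lemma emb_alpha i k : emb (alpha i) k = (k == lo i)%:R - (k == hi i)%:R.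
Proof.
rewrite /emb (bigD1 i) //= ffunE eqxx mul1r big1 ?addr0 // => j ji.
by rewrite ffunE (negbTE ji) mul0r.
Qed.

Lemma coef_emb i v : coef farb nextb i v = emb v (lo i) - emb v (hi i).
Proof.
rewrite /coef /emb -sumrB; apply: eq_bigr => j _; rewrite -mulrBr mulrC; congr (_ * _).
rewrite /bil /farb /nextb -!val_eqE /= eqSS.
by do ![case: eqP => ? /= | case: ltnP => ? /=]; lia.
Qed.

Lemma emb_refl i v k : emb (refl farb nextb i v) k = emb v (adj_transp i k).
Proof.
rewrite emb_lin emb_alpha coef_emb.
case: (eqVneq k (lo i)) => [->|kl].
  by rewrite adj_transp_lo ?eqxx (negbTE (lo_hi i)) /=; ring.
case: (eqVneq k (hi i)) => [->|kh]; first by rewrite adj_transp_hi /=; ring.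
by rewrite adj_transp_id //=; ring.
Qed.

Lemma emb_act u v k : emb (act farb nextb u v) k = emb v (sprod u k).
Proof.
by elim: u v k => [|i u IH] v k; rewrite ?perm1 //= emb_refl IH permM.
Qed.

Lemma emb_inj v : emb v =1 (fun=> 0) -> forall i, v i = 0.
Proof.
move=> v0 i; have [m] := ubnP (nat_of_ord i); elim: m i => // m IH i im.
have := v0 (lo i); rewrite /emb (bigD1 i) //= eqxx (negbTE (lo_hi i)) big1 ?addr0.
  by rewrite /= mulr1.
move=> j ji; case: (eqVneq (lo i) (hi j)) => [/(congr1 val) /= E|_].
  by rewrite IH ?mul0r //; lia.
case: eqP => [/(congr1 val) /= E|_]; last by rewrite subrr mulr0.
by case/eqP: ji; apply: val_inj.
Qed.

(** In Z^n the reflections become transpositions of coordinates, so the action on the root lattice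
    depends only on the permutation. *)
Lemma act_sprod u w : sprod u = sprod w ->
  act farb nextb u =1 act farb nextb w.
Proof.
move=> uw v; apply/ffunP => i.
have := @emb_inj (lin 1 (act farb nextb u v) (-1) (act farb nextb w v)) _ i.
rewrite ffunE => H.
suff: 1 * act farb nextb u v i + -1 * act farb nextb w v i = 0 by lia.
by apply: H => k; rewrite emb_lin !emb_act uw; ring.
Qed.

Lemma adj_transp_far i j : farb i j ->
  (adj_transp i * adj_transp j = adj_transp j * adj_transp i)%g.
Proof.
move=> ij; apply/commgP/conjg_fixP; rewrite adj_transpE tpermJ.
by rewrite !adj_transp_id // -val_eqE /=; move: ij; rewrite /farb; lia.
Qed.

Lemma adj_transp_next (i j : I) : j = i.+1 :> nat ->
  (adj_transp i * (adj_transp j * adj_transp i) =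
   adj_transp j * (adj_transp i * adj_transp j))%g.
Proof.
move=> ij; have hl : hi i = lo j by apply: val_inj; rewrite /= ij.
have -> : (adj_transp i * (adj_transp j * adj_transp i) = adj_transp j ^ adj_transp i)%g.
  by rewrite /conjg adj_transpV.
have -> : (adj_transp j * (adj_transp i * adj_transp j) = adj_transp i ^ adj_transp j)%g.
  by rewrite /conjg adj_transpV.
have -> : (adj_transp j ^ adj_transp i = tperm (lo i) (hi j))%g.
  rewrite [adj_transp j]adj_transpE tpermJ -hl adj_transp_hi adj_transp_id //;
    by rewrite -val_eqE /= ij; lia.
rewrite [adj_transp i]adj_transpE tpermJ hl adj_transp_lo adj_transp_id //;
  by rewrite -val_eqE /= ?ij; lia.
Qed.

Section Presentation.
Variables (H : groupType) (v : I -> H).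
Hypotheses (v2 : forall i, (v i * v i = 1)%g)
  (v_far : forall i j, farb i j -> (v i * v j = v j * v i)%g)
  (v_next : forall i j : I, j = i.+1 :> nat ->
     (v i * (v j * v i) = v j * (v i * v j))%g).

Definition vprod (u : seq I) : H := foldr (fun i h => (v i * h)%g) 1%g u.

Lemma vprod_cat u w : vprod (u ++ w) = (vprod u * vprod w)%g.
Proof. by elim: u => [|i u /= ->]; rewrite ?mul1g ?mulgA. Qed.

Lemma vprod_rev u : vprod (rev u) = (vprod u)^-1%g.
Proof.
elim: u => [|i u IH]; first by rewrite invg1.
rewrite rev_cons -cats1 vprod_cat /= IH mulg1 invgM; congr (_ * _)%g.
by apply: esym; apply: mulg1_eq; exact: v2.
Qed.

(* Coxeter's presentation of the symmetric group, deduced from the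
   faithfulness of the geometric representation. *)
Lemma vprod_sprod1 u : sprod u = 1%g -> vprod u = 1%g.
Proof.
move=> u1; suff [] : vprod u = vprod [::] /\ sprod u = sprod [::] by [].
(* The component [sprod] makes congruent words act alike, as [act_faithful_of] requires; the
   component [vprod] carries the conclusion. *)
apply: (act_faithful_of farb_sym nextb_sym
  (E := fun u w => vprod u = vprod w /\ sprod u = sprod w)) => //.
- by move=> ? ? [-> ->].
- by move=> ? ? ? [-> ->].
- by move=> ? ? ? [e1 e2]; rewrite !vprod_cat !sprod_cat e1 e2.
- by move=> w i; rewrite vprod_cat sprod_cat /= !mulg1 v2 adj_transp2 !mulg1.
- move=> w i j ij; rewrite !vprod_cat !sprod_cat /= !mulg1.
  by rewrite v_far // adj_transp_far.
- have br (i j : I) : j = i.+1 :> nat -> forall w,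
      vprod (w ++ [:: i; j; i]) = vprod (w ++ [:: j; i; j]) /\
      sprod (w ++ [:: i; j; i]) = sprod (w ++ [:: j; i; j]).
    move=> ij w; rewrite !vprod_cat !sprod_cat /= !mulg1.
    by rewrite v_next // adj_transp_next.
  move=> w i j /orP[/eqP ij|/eqP ji]; first exact: br.
  by have [e1 e2] := br _ _ ji w.
- by move=> ? ? [_ e]; exact: act_sprod.
- exact: (act_sprod (w := [::])).
Qed.

Lemma vprod_sprod u w : sprod u = sprod w -> vprod u = vprod w.
Proof.
move=> uw; apply: divg1_eq; rewrite -vprod_rev -vprod_cat; apply: vprod_sprod1.
by rewrite sprod_cat sprod_rev uw mulgV.
Qed.

Definition word_of (p : 'S_n) : seq I := projT1 (cid (sprod_surj p)).
Lemma word_ofK p : sprod (word_of p) = p. Proof. exact: projT2 (cid (sprod_surj p)). Qed.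

Definition iota_S (p : 'S_n) : H := vprod (word_of p).

Lemma iota_sprod u : iota_S (sprod u) = vprod u.
Proof. by apply: vprod_sprod; rewrite word_ofK. Qed.
Lemma iotaM p q : iota_S (p * q)%g = (iota_S p * iota_S q)%g.
Proof. by rewrite -{1}(word_ofK p) -{1}(word_ofK q) -sprod_cat iota_sprod vprod_cat. Qed.
Lemma iota1 : iota_S 1%g = 1%g. Proof. exact: (iota_sprod [::]). Qed.
Lemma iotaV p : iota_S p^-1%g = (iota_S p)^-1%g.
Proof. by rewrite -{1}(word_ofK p) -sprod_rev iota_sprod vprod_rev. Qed.
Lemma iota_adj i : iota_S (adj_transp i) = v i.
Proof. by have := iota_sprod [:: i]; rewrite /= !mulg1. Qed.

End Presentation.
End AdjacentTranspositions.

(** * Virtual groups *)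

Local Open Scope group_scope.

Section VirtualGroup.
(** [tw] selects the twin case, where the letters s_i are involutions and the label 3 does not
    occur; otherwise the braid case is meant. *)
Variables (n : nat) (tw : bool).
Hypothesis n_gt2 : (2 < n)%N.
Local Notation I := 'I_n.-1.
Local Notation adj_transp := (@adj_transp n).
Local Notation farn := (@farb n).

Definition opair := {x : 'I_n * 'I_n | x.1 != x.2}.

Lemma pact_subproof (p : 'S_n) (x : opair) : p (val x).1 != p (val x).2.
Proof. by rewrite (inj_eq perm_inj); exact: (valP x). Qed.
Definition pact (p : 'S_n) (x : opair) : opair :=
  exist _ (p (val x).1, p (val x).2) (pact_subproof p x).
Definition delta0 (i : I) : opair := exist _ (lo i, hi i) (lo_hi i).

Definition ocom : rel opair := fun x y =>
  [&& (val x).1 != (val y).1, (val x).1 != (val y).2,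
      (val x).2 != (val y).1 & (val x).2 != (val y).2].
Definition obr : rel opair := fun x y => ~~ tw &&
  (((val x).2 == (val y).1) && ((val x).1 != (val y).2) ||
   ((val x).1 == (val y).2) && ((val x).2 != (val y).1)).

Lemma ocom_sym : symmetric ocom.
Proof.
move=> x y; rewrite /ocom ![(val y).1 == _]eq_sym ![(val y).2 == _]eq_sym.
by case: eqP; case: eqP; case: eqP; case: eqP.
Qed.
Lemma obr_sym : symmetric obr.
Proof.
move=> x y; rewrite /obr ![(val y).1 == _]eq_sym ![(val y).2 == _]eq_sym.
by rewrite orbC.
Qed.
Lemma ocom_irr : irreflexive ocom. Proof. by move=> x; rewrite /ocom eqxx. Qed.
Lemma obr_irr : irreflexive obr.
Proof.
move=> x; have x12 : ((val x).1 == (val x).2) = false := negbTE (valP x).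
by rewrite /obr [(val x).2 == _]eq_sym x12 /=; case: tw.
Qed.
Lemma ocom_obr x y : ocom x y -> ~~ obr x y.
Proof.
by rewrite /ocom /obr => /and4P[_ /negbTE-> /negbTE-> _]; case: tw.
Qed.
Lemma pact_ocom p x y : ocom (pact p x) (pact p y) = ocom x y.
Proof. by rewrite /ocom /= !(inj_eq perm_inj). Qed.
Lemma pact_obr p x y : obr (pact p x) (pact p y) = obr x y.
Proof. by rewrite /obr /= !(inj_eq perm_inj). Qed.
Lemma ocom_delta0 i j : farn i j -> ocom (delta0 i) (delta0 j).
Proof. by rewrite /ocom /farb -!val_eqE /=; lia. Qed.
Lemma obr_delta0 (i j : I) : ~~ tw -> j = i.+1 :> nat -> obr (delta0 i) (delta0 j).
Proof. by rewrite /obr -!val_eqE /= => -> ij; rewrite ij eqxx /= neq_ltn; lia. Qed.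

Lemma opair_ext (x y : opair) : (val x).1 = (val y).1 -> (val x).2 = (val y).2 -> x = y.
Proof.
by move=> h1 h2; apply: val_inj; rewrite [LHS]surjective_pairing [RHS]surjective_pairing h1 h2.
Qed.

Lemma opair_inf x : exists y z : opair,
  [/\ y != z, bil ocom obr x y = (- 2%:Z)%R & bil ocom obr x z = (- 2%:Z)%R].
Proof.
case: x => -[a b] /= ab.
have [c ca cb] : exists2 c : 'I_n, c != a & c != b.
  have : (0 < #|~: [set a; b]|)%N.
    by rewrite cardsCs setCK cards2 ab card_ord; lia.
  by case/card_gt0P => c; rewrite !inE negb_or => /andP[ca cb]; exists c.
have ba : (b, a).1 != (b, a).2 by rewrite eq_sym.
have ac : (a, c).1 != (a, c).2 by rewrite eq_sym.
exists (exist _ (b, a) ba), (exist _ (a, c) ac); split.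
- by rewrite -val_eqE /= xpair_eqE eq_sym (negbTE ab).
- rewrite /bil -val_eqE /= xpair_eqE (negbTE ab) /ocom /obr /=.
  by rewrite !eqxx /=; case: (a == b); case: tw.
- rewrite /bil -val_eqE /= xpair_eqE eqxx /= [b == c]eq_sym (negbTE cb) /ocom /obr /=.
  by rewrite eqxx /= [b == a]eq_sym (negbTE ab) [a == c]eq_sym (negbTE ca) /=; case: tw.
Qed.

Local Notation G := (gp (gg_rel ocom obr tw)).
Local Notation gg := (gen (gg_rel ocom obr tw)).
Local Notation gl := (lval (gg_rel ocom obr tw)).

Variables (T : Type) (R : word T -> word T -> Prop).
(** The alphabet stays abstract, [dec] sorting its letters into crossings and permutation letters,
    so that both virtual groups are instances. *)
Variables (sg vg : I -> T) (dec : T -> I + I).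
Hypothesis decK : forall t, t = match dec t with inl i => sg i | inr i => vg i end.
Hypotheses (dec_sg : forall i, dec (sg i) = inl i) (dec_vg : forall i, dec (vg i) = inr i).

(* [o.2] is the inverse of the permutation read so far. *)
Definition vstep (o : G * 'S_n) (a : letter T) : G * 'S_n :=
  match dec a.1 with
  | inl i => (o.1 * gl (pact o.2 (delta0 i), a.2), o.2)
  | inr i => (o.1, adj_transp i * o.2)
  end.

Let ps i : letter T := (sg i, false).
Let pv i : letter T := (vg i, false).

Lemma vstep_s g p i e : vstep (g, p) (sg i, e) = (g * gl (pact p (delta0 i), e), p).
Proof. by rewrite /vstep /= dec_sg. Qed.
Lemma vstep_v g p i e : vstep (g, p) (vg i, e) = (g, adj_transp i * p).
Proof. by rewrite /vstep /= dec_vg. Qed.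

Lemma pact_far p i j : farn i j -> pact (adj_transp j * p) (delta0 i) = pact p (delta0 i).
Proof.
rewrite /farb => ij; apply: opair_ext; rewrite /= permM adj_transp_id //;
by rewrite -val_eqE /=; lia.
Qed.

Lemma vstep_sfar i j o : farn i j ->
  foldl vstep o [:: ps i; ps j] = foldl vstep o [:: ps j; ps i].
Proof.
case: o => g p ij; rewrite /= !vstep_s -!mulgA; congr (_ * _, _).
by apply: gen_com; rewrite pact_ocom; exact: ocom_delta0.
Qed.

Lemma vstep_snext (i j : I) o : ~~ tw -> j = i.+1 :> nat ->
  foldl vstep o [:: ps i; ps j; ps i] = foldl vstep o [:: ps j; ps i; ps j].
Proof.
case: o => g p ntw ij; rewrite /= !vstep_s -!mulgA; congr (_ * _, _).
by apply: gen_br; rewrite pact_obr; exact: obr_delta0.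
Qed.

Lemma vstep_ssq i o : tw -> foldl vstep o [:: ps i; ps i] = o.
Proof.
by case: o => g p ht; rewrite /= !vstep_s -!mulgA gen_sq ?mulg1.
Qed.

Lemma vstep_vsq i o : foldl vstep o [:: pv i; pv i] = o.
Proof. by case: o => g p; rewrite /= !vstep_v mulgA adj_transp2 mul1g. Qed.

Lemma vstep_vfar i j o : farn i j ->
  foldl vstep o [:: pv i; pv j] = foldl vstep o [:: pv j; pv i].
Proof. by case: o => g p ij; rewrite /= !vstep_v !mulgA (adj_transp_far ij). Qed.

Lemma vstep_vnext (i j : I) o : j = i.+1 :> nat ->
  foldl vstep o [:: pv i; pv j; pv i] = foldl vstep o [:: pv j; pv i; pv j].
Proof.
case: o => g p ij; rewrite /= !vstep_v !mulgA; congr (_, _ * _).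
by rewrite -!mulgA (adj_transp_next ij).
Qed.

Lemma vstep_svfar i j o : farn i j ->
  foldl vstep o [:: ps i; pv j] = foldl vstep o [:: pv j; ps i].
Proof. by case: o => g p ij; rewrite /= !(vstep_s, vstep_v) pact_far. Qed.

Lemma vstep_mixed (i j : I) o : j = i.+1 :> nat ->
  foldl vstep o [:: pv i; pv j; ps i] = foldl vstep o [:: ps j; pv i; pv j].
Proof.
case: o => g p ij; rewrite /= !(vstep_s, vstep_v); congr (_ * gl (_, _), _).
have hl : hi i = lo j by apply: val_inj; rewrite /= ij.
have e1 : adj_transp j (lo i) = lo i.
  by apply: adj_transp_id; rewrite -val_eqE /=; lia.
have e2 : adj_transp i (hi j) = hi j.
  by apply: adj_transp_id; rewrite -val_eqE /=; lia.
apply: opair_ext; rewrite /= !permM; first by rewrite e1 adj_transp_lo hl.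
by rewrite hl adj_transp_lo e2.
Qed.

Hypothesis stepR : forall l r, R l r ->
  forall o, foldl vstep o l = foldl vstep o r.

Lemma vstepK o a : vstep (vstep o a) (lflip a) = o.
Proof.
case: o a => g p [t e]; rewrite /vstep /=; case: (dec t) => i /=.
  by rewrite -mulgA -[(_, ~~ e)]/(lflip (_, e)) lval_flip mulgV mulg1.
by rewrite mulgA adj_transp2 mul1g.
Qed.

Lemma vstepP u w : pres_eq R u w -> forall o, foldl vstep o u = foldl vstep o w.
Proof.
move=> uw o; apply: (pres_eq_foldl (inv := fun=> True)) uw _ _ => // [{}o a _|{}o l r _].
  exact: vstepK.
by move/stepR.
Qed.

Lemma vstep_trans h g p u :
  foldl vstep (h * g, p) u =
  (h * (foldl vstep (g, p) u).1, (foldl vstep (g, p) u).2).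
Proof.
elim: u g p => //= -[t e] u IH g p; rewrite /vstep /=; case: (dec t) => i.
  by rewrite -mulgA IH.
by rewrite IH.
Qed.

Definition vperm (t : T) : 'S_n :=
  match dec t with inl _ => 1 | inr i => adj_transp i end.

Lemma vstep_perm u o : (foldl vstep o u).2 = (eval_perm vperm u)^-1 * o.2.
Proof.
elim: u o => [|[t e] u IH] [g p] /=; first by rewrite invg1 mul1g.
rewrite IH /vstep /= /vperm; case: (dec t) => i /=.
  by rewrite invg1 if_same mul1g.
by rewrite adj_transpV if_same invMg adj_transpV mulgA.
Qed.

(** * Recovering the class of a word from its final state *)

Local Notation H := (gp R).
Let si i : H := gen R (sg i).
Let nu i : H := gen R (vg i).
Hypotheses (nu2 : forall i, nu i * nu i = 1)
  (nu_far : forall i j, farn i j -> nu i * nu j = nu j * nu i)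
  (nu_next : forall i j : I, j = i.+1 :> nat -> nu i * (nu j * nu i) = nu j * (nu i * nu j))
  (si_nu_far : forall i j, farn i j -> si i * nu j = nu j * si i)
  (mixed : forall i j : I, j = i.+1 :> nat -> nu i * (nu j * si i) = si j * (nu i * nu j))
  (si_far : forall i j, farn i j -> si i * si j = si j * si i)
  (si_next : forall i j : I, ~~ tw -> j = i.+1 :> nat -> si i * (si j * si i) = si j * (si i * si j))
  (si_sq : forall i, tw -> si i * si i = 1).

Let io : 'S_n -> H := iota_S nu.
Let ioM p q : io (p * q) = io p * io q. Proof. exact: iotaM. Qed.
Let io1 : io 1 = 1. Proof. exact: iota1. Qed.
Let io_adj i : io (adj_transp i) = nu i. Proof. exact: iota_adj. Qed.

Let ord_pred_gt k : (k.+1 < n)%N -> (k < n.-1)%N. Proof. lia. Qed.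
Let i0 : I := Ordinal (ord_pred_gt (ltnW n_gt2)).
Let i1 : I := Ordinal (ord_pred_gt n_gt2).

Let cj p (h : H) := io p * (h * (io p)^-1).

Let cjM p q h : cj p (cj q h) = cj (p * q) h.
Proof. by rewrite /cj ioM invgM !mulgA. Qed.

(** Such a [q] is a product of adjacent transpositions of index at least 2, all far from the first
    one, and their images commute with [si i0]. *)
Let cj_fix (q : 'S_n) : q (lo i0) = lo i0 -> q (hi i0) = hi i0 -> cj q (si i0) = si i0.
Proof.
move=> q0 q1; have [|u u2 <-] := @sprod_stab n 2 q.
  move=> x; rewrite ltnS leq_eqVlt ltnS leqn0 => /orP[/eqP x1|/eqP x0].
    by have -> : x = hi i0 by exact: val_inj.
  by have -> : x = lo i0 by exact: val_inj.
rewrite /cj /io (iota_sprod nu2 nu_far nu_next) mulgA.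
suff -> : vprod nu u * si i0 = si i0 * vprod nu u by rewrite mulgK.
elim: u u2 => [|i u IH] /=; first by rewrite mul1g mulg1.
case/andP=> i2 /IH E; rewrite -mulgA E !mulgA si_nu_far // /farb /=.
by rewrite i2.
Qed.

Let cj_base (i : I) : exists2 p : 'S_n, p (lo i0) = lo i /\ p (hi i0) = hi i & cj p (si i) = si i0.
Proof.
case: i => i; elim: i => [|i IH] ilt.
  exists 1; first by rewrite !perm1; split; exact: val_inj.
  rewrite /cj io1 mul1g invg1 mulg1; congr si; exact: val_inj.
have [p [pl ph] pE] := IH (ltnW ilt).
move: pl ph pE; set j := Ordinal ilt; set k := Ordinal (ltnW ilt) => pl ph pE.
have jk : j = k.+1 :> nat by [].
have hl : hi k = lo j by exact: val_inj.
(* The mixed relation says that conjugation by [nu j * nu k] takes [si j] to [si k]. *)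
exists (p * (adj_transp j * adj_transp k)).
  have e1 : adj_transp j (lo k) = lo k.
    by apply: adj_transp_id; rewrite -val_eqE /=; lia.
  have e2 : adj_transp k (hi j) = hi j.
    by apply: adj_transp_id; rewrite -val_eqE /=; lia.
  by rewrite !permM pl ph e1 adj_transp_lo hl adj_transp_lo e2.
rewrite -cjM -pE; congr cj; rewrite /cj ioM !io_adj invgM.
have V i' : (nu i')^-1 = nu i' by apply: mulg1_eq; exact: nu2.
rewrite !V -mulgA; have := mixed jk => E.
by rewrite -E (mulgA (nu k)) nu2 mul1g mulgA nu2 mul1g.
Qed.

Let cj_eq (p q : 'S_n) (i j : I) : p^-1 (lo i) = q^-1 (lo j) -> p^-1 (hi i) = q^-1 (hi j) ->
  cj p (si i) = cj q (si j).
Proof.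
move=> el eh; have [r [rl rh] rE] := cj_base i; have [s [sl sh] sE] := cj_base j.
have -> : si i = cj r^-1 (si i0) by rewrite -rE cjM mulVg /cj io1 mul1g invg1 mulg1.
have -> : si j = cj s^-1 (si i0) by rewrite -sE cjM mulVg /cj io1 mul1g invg1 mulg1.
rewrite !cjM; have E : p * r^-1 = q * s^-1 * (s * q^-1 * p * r^-1).
  by rewrite !mulgA mulgKV mulgV mul1g.
rewrite E -cjM cj_fix // !permM.
  by rewrite sl -el permKV -rl permK.
by rewrite sh -eh permKV -rh permK.
Qed.

Let frame (x : opair) : exists p : 'S_n, p (val x).1 = lo i0 /\ p (val x).2 = hi i0.
Proof.
have [|||p] := @perm_trans 'I_n [:: (val x).1; (val x).2] [:: lo i0; hi i0]; rewrite /= ?inE ?andbT //.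
- exact: (valP x).
- by case=> h1 h2; exists p.
Qed.

(** The element of the virtual group attached to an ordered pair of strands; by [cj_eq] the
    permutation chosen by [frame] does not matter. *)
Let dl (x : opair) : H := cj (projT1 (cid (frame x))) (si i0).

Let dlE p i : dl (pact p^-1 (delta0 i)) = cj p (si i).
Proof.
rewrite /dl; case: cid => q /= [ql qh]; apply: cj_eq.
  by rewrite -ql permK.
by rewrite -qh permK.
Qed.

Let dlE' p i : dl (pact p (delta0 i)) = cj p^-1 (si i).
Proof. by rewrite -dlE invgK. Qed.

Let psi_step (h : H) (a : letter opair) := h * (if a.2 then (dl a.1)^-1 else dl a.1).

Let pact_onto x i : exists p, x = pact p (delta0 i).
Proof.
have [|||p] := @perm_trans 'I_n [:: lo i; hi i] [:: (val x).1; (val x).2]; rewrite /= ?inE ?andbT ?lo_hi //.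
- exact: (valP x).
- by case=> h1 h2; exists p; apply: opair_ext.
Qed.

(** S_n is transitive on tuples of distinct strands, so each relation is conjugate to one in
    standard position: (0,1) and (1,2) for a braid, (0,1) and (2,3) for a commutation, whose four
    distinct strands force n > 3. *)
Let psi_rel l r : gg_rel ocom obr tw l r -> forall h : H, foldl psi_step h l = foldl psi_step h r.
Proof.
have cjMh p a b : cj p a * cj p b = cj p (a * b).
  by rewrite /cj -!mulgA mulKg.
case=> [x y xy|x y xy|x ht] h; rewrite /psi_step /= -!(mulgA h); last first.
- have [p ->] := pact_onto x i0; rewrite dlE' cjMh si_sq //.
  by rewrite /cj mul1g mulgV mulg1.
- congr (_ * _); wlog xy' : x y xy / ((val x).2 == (val y).1) && ((val x).1 != (val y).2).
    move: (xy) => /andP[_ /orP[xy'|xy']] W; first exact: W.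
    by apply: esym; apply: W; rewrite 1?obr_sym // eq_sym andbC eq_sym andbC.
  have /andP[/eqP xy2 xy1] := xy'.
  have [|||p] := @perm_trans 'I_n [:: lo i0; hi i0; hi i1] [:: (val x).1; (val x).2; (val y).2];
    rewrite /= ?inE ?andbT ?negb_or //.
    by rewrite xy1 (valP x) xy2 (valP y).
  case=> h1 h2 h3.
  have -> : x = pact p (delta0 i0) by apply: opair_ext.
  have -> : y = pact p (delta0 i1).
    apply: opair_ext; rewrite /= ?h3 // -xy2 -h2; congr (p _); exact: val_inj.
  rewrite !dlE' !cjMh -(mulgA (si i0) (si i1)) -(mulgA (si i1) (si i0)) si_next //.
  by case/andP: xy.
congr (_ * _); have /and4P[d1 d2 d3 d4] := xy.
have n3 : (3 < n)%N.
  have := subset_leq_card (subset_predT (mem [:: (val x).1; (val x).2; (val y).1; (val y).2])).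
  rewrite card_ord; have /card_uniqP -> // : uniq [:: (val x).1; (val x).2; (val y).1; (val y).2].
  by rewrite /= !inE !negb_or d1 d2 d3 d4 (valP x) (valP y).
pose i2 : I := Ordinal (ord_pred_gt n3).
have [|||p] := @perm_trans 'I_n [:: lo i0; hi i0; lo i2; hi i2] [:: (val x).1; (val x).2; (val y).1; (val y).2];
    rewrite /= ?inE ?andbT ?negb_or //.
  by rewrite d1 d2 d3 d4 (valP x) (valP y).
case=> h1 h2 h3 h4.
have -> : x = pact p (delta0 i0) by apply: opair_ext.
have -> : y = pact p (delta0 i2) by apply: opair_ext.
by rewrite !dlE' !cjMh si_far.
Qed.

Let psi (g : G) : H := foldl psi_step 1 (rep g).

Let psi_cls u : psi (cls _ u) = foldl psi_step 1 u.
Proof.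
apply: (pres_eq_foldl (R := gg_rel ocom obr tw) (inv := fun=> True)) => // [o a _|o l r _ lr|].
- by rewrite /psi_step /=; case: a.2; rewrite /= ?mulgK ?mulgVK.
- exact: psi_rel.
- by apply/clsP; rewrite repK.
Qed.

Let psi_mul g a : psi (g * gl a) = psi_step (psi g) a.
Proof. by rewrite -(repK g) -cls_rcons psi_cls foldl_rcons -psi_cls. Qed.

Let psi1 : psi 1 = 1. Proof. exact: (psi_cls [::]). Qed.

Let recover u : cls R u = psi (foldl vstep (1, 1) u).1 * io (foldl vstep (1, 1) u).2^-1.
Proof.
elim/last_ind: u => [|u [t e] IH]; first by rewrite /= psi1 invg1 io1 mulg1.
rewrite foldl_rcons cls_rcons IH; case: (foldl _ _ u) => g p /=.
rewrite (decK t); case: (dec t) => i; last first.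
  rewrite vstep_v /= invMg adj_transpV ioM io_adj /lval /= -mulgA; congr (_ * (_ * _)).
  have -> : gen R (vg i) = nu i by [].
  by case: e => //; apply: mulg1_eq; exact: nu2.
rewrite vstep_s /= psi_mul /psi_step /= dlE' -!mulgA; congr (_ * _).
rewrite /lval /= -/(si i) /cj; case: e; last by rewrite -!mulgA mulVg mulg1.
by rewrite !invgM invgK -!mulgA mulVg mulg1.
Qed.

Lemma vstep_faithful u : foldl vstep (1, 1) u = (1, 1) -> pres_eq R u [::].
Proof. by move=> E; apply/clsP; rewrite recover E /= psi1 invg1 io1 mulg1. Qed.

(** [c] brings [x] to standard position and is undone after one crossing. All states are allowed
    because [y] will also be read after a word of non-trivial permutation. *)
Lemma vstep_lift x : exists y, forall g q, foldl vstep (g, q) y = (g * gg (pact q x), q).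
Proof.
have [p xE] := pact_onto x i0; have [u uE] := sprod_surj p^-1.
pose c := [seq (vg i, false) | i <- u] : word T.
have cE g q : foldl vstep (g, q) c = (g, p * q).
  rewrite -[p]invgK -uE /c; elim: u q {uE c} => [|i u IH] q /=; first by rewrite invg1 mul1g.
  by rewrite vstep_v IH invMg adj_transpV !mulgA.
have cE' g q : foldl vstep (g, p * q) (winv c) = (g, q).
  have := vstepP (pres_eq_mulV R c) (g, q).
  by rewrite foldl_cat cE.
exists (c ++ [:: (sg i0, false)] ++ winv c) => g q.
rewrite !foldl_cat cE /= vstep_s cE'.
have -> // : pact (p * q) (delta0 i0) = pact q x.
by rewrite xE; apply: opair_ext; rewrite /= permM.
Qed.

Lemma pact1 x : pact 1 x = x.
Proof. by apply: opair_ext; rewrite /= perm1. Qed.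

Lemma vstep_lift1 x : exists y, foldl vstep (1, 1) y = (x, 1).
Proof.
have [u <-] := cls_surj x; elim/last_ind: u => [|u [s e] [y yE]].
  by exists [::].
have [z zE] := vstep_lift s; rewrite cls_rcons.
exists (y ++ if e then winv z else z); rewrite foldl_cat yE /lval /=; case: e.
  have := vstepP (pres_eq_Vmul R z) (cls _ u, 1); rewrite foldl_cat.
  case: (foldl _ _ (winv z)) => g q; rewrite zE /= => E.
  have q1 : q = 1 := congr1 snd E; rewrite q1 pact1 in E *.
  by rewrite -(congr1 fst E : g * gg s = cls _ u) mulgK.
by rewrite zE pact1.
Qed.

Lemma vstep_winv y x : foldl vstep (1, 1) y = (x, 1) ->
  foldl vstep (1, 1) (winv y) = (x^-1, 1).
Proof.
move=> yE; have := vstepP (pres_eq_mulV R y) (1, 1); rewrite foldl_cat yE /=.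
rewrite -{1}(mulg1 x) vstep_trans; case: (foldl _ _ _) => g q E.
rewrite (congr1 snd E : q = 1); congr (_, _).
by apply: esym; apply: mulg1_eq; exact: (congr1 fst E).
Qed.

(** Words of trivial permutation are read multiplicatively and reach all of G, so the image of [N]
    in G is commutative and stable under conjugation. *)
Theorem no_abelian_normal_kernel :
  no_nontrivial_abelian_normal_in R (ker_perm vperm).
Proof.
move=> N nN Nker u Nu.
pose NG (g : G) := exists2 w, N w & foldl vstep (1, 1) w = (g, 1).
have vs w : N w -> exists g, foldl vstep (1, 1) w = (g, 1).
  move=> /Nker kw; have := vstep_perm w (1, 1); rewrite kw invg1 mulg1.
  by case: (foldl _ _ _) => g p /= ->; exists g.
have [g uE] := vs u Nu; apply: vstep_faithful; rewrite uE; congr (_, _).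
apply: (@abelian_normal_trivial _ _ _ ocom_sym obr_sym ocom_irr obr_irr ocom_obr tw
  opair_inf NG); last by exists u.
  move=> x y [w Nw wE]; have [z zE] := vstep_lift1 y.
  exists (winv z ++ w ++ z); first exact: (nas_normal nN).
  rewrite !foldl_cat (vstep_winv zE) -{1}(mulg1 y^-1) vstep_trans wE /=.
  by rewrite -{1}(mulg1 (y^-1 * x)) vstep_trans zE /= mulgA.
move=> x y [w Nw wE] [w' Nw' wE']; have := vstepP (nas_abelian nN Nw Nw') (1, 1).
rewrite !foldl_cat wE wE' -{1}(mulg1 x) -{1}(mulg1 y) !vstep_trans wE wE'.
exact: (congr1 fst).
Qed.

Lemma abelian_normal_sub_kernel N : tw -> normal_abelian_subgroup R N ->
  forall u, N u -> ker_perm vperm u.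
Proof.
move=> ht nN u Nu.
pose N0 w := N w /\ ker_perm vperm w.
have evalE w : (foldl vstep (1, 1) w).2 = (eval_perm vperm w)^-1.
  by rewrite vstep_perm mulg1.
have N0P w : N w -> (foldl vstep (1, 1) w).2 = 1 -> pres_eq R w [::].
  have nN0 : normal_abelian_subgroup R N0.
    have kerE w' : ker_perm vperm w' <-> (foldl vstep (1, 1) w').2 = 1.
      rewrite /ker_perm evalE; split=> [->|/(congr1 (fun p => p^-1))]; first exact: invg1.
      by rewrite invgK invg1.
    have pair w' : ker_perm vperm w' -> exists x, foldl vstep (1, 1) w' = (x, 1).
      by move/kerE; case: (foldl _ _ _) => x p /= ->; exists x.
    split.
    - move=> a b ab [Na ka]; split; first exact: (nas_compat nN ab).
      by apply/kerE; rewrite -(vstepP ab); apply/kerE.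
    - by split; [exact: (nas_one nN)|].
    - move=> a b [Na ka] [Nb kb]; split; first exact: (nas_mul nN).
      apply/kerE; rewrite foldl_cat; have [x ->] := pair _ ka; have [y yE] := pair _ kb.
      by rewrite -(mulg1 x) vstep_trans yE.
    - move=> a [Na ka]; split; first exact: (nas_inv nN).
      by have [x xE] := pair _ ka; apply/kerE; rewrite (vstep_winv xE).
    - move=> a g [Na ka]; split; first exact: (nas_normal nN).
      have [x xE] := pair _ ka; apply/kerE; rewrite !foldl_cat.
      have := vstepP (pres_eq_Vmul R g) (1, 1); rewrite foldl_cat.
      rewrite !vstep_perm.
      have -> : (eval_perm vperm a)^-1 = 1 by rewrite ka invg1.
      by rewrite mul1g => /(congr1 snd) /=; rewrite !vstep_perm.
    - by move=> a b [Na _] [Nb _]; exact: (nas_abelian nN).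
  move=> Nw kw; apply: (no_abelian_normal_kernel nN0) => [v []//|]; split=> //.
  by move: kw; rewrite evalE => /(congr1 (fun p => p^-1)); rewrite invgK invg1.
case uE : (foldl vstep (1, 1) u) => [gu pu].
suff pu1 : pu = 1.
  have := evalE u; rewrite uE /= pu1 => /(congr1 (fun p => p^-1)).
  by rewrite invgK invg1 /ker_perm => <-.
suff fixp x : pact pu x = x.
  apply/permP => a; rewrite perm1.
  have : (0 < #|[set~ a]|)%N by rewrite cardsC1 card_ord; lia.
  case/card_gt0P => b; rewrite !inE eq_sym => ab.
  by have /(congr1 (fun x => (val x).1)) := fixp (exist _ (a, b) ab).
have [y yE] := vstep_lift x.
have y1 : foldl vstep (1, 1) y = (gg x, 1) by rewrite yE pact1 mul1g.
(* The commutator of [y] and [u] lies in [N] by normality and has trivial permutation because [y]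
   has, so it is trivial. *)
have ux : pres_eq R (y ++ u) (u ++ y).
  have NC : N ((winv y ++ winv u ++ y) ++ u).
    apply: (nas_mul nN) => //; apply: (nas_normal nN); exact: (nas_inv nN).
  apply/clsP; rewrite !cls_cat.
  have /clsP : pres_eq R ((winv y ++ winv u ++ y) ++ u) [::].
    apply: N0P NC _; rewrite !foldl_cat; have := vstepP (pres_eq_Vmul R u) (1, 1).
    rewrite foldl_cat (vstep_winv y1); case wE : (foldl _ _ (winv u)) => [gw pw].
    move=> /(congr1 snd); rewrite vstep_perm /= => pw1.
    rewrite -{1}(mulg1 (gg x)^-1) vstep_trans wE yE vstep_perm.
    exact: pw1.
  rewrite !cls_cat !cls_winv cls0 => E.
  rewrite -[RHS]mulg1 -E !mulgA mulgK.
  by rewrite mulgV mul1g.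
have := vstepP ux (1, 1); rewrite !foldl_cat y1 uE yE -{1}(mulg1 (gg x)) vstep_trans uE /=.
move=> /(congr1 fst) /= E.
(* The parity of the occurrences of [x] is a homomorphism to Z/2 on the right-angled Coxeter group;
   it separates the generator [x] from all the others modulo commutators. *)
pose flip (b : bool) (a : letter opair) := b (+) (a.1 == x).
have flipP w w' : cls (gg_rel ocom obr tw) w = cls _ w' -> foldl flip false w = foldl flip false w'.
  move/clsP => ww; apply: (pres_eq_foldl (f := flip) (inv := fun=> True)) ww _ _ => //.
    by move=> b a _; rewrite /flip /= -addbA addbb addbF.
  move=> b l r _ [s t st|s t|s _] /=; rewrite /flip /=.
  - by rewrite -!addbA (addbC (s == x)).
  - by rewrite /obr ht.
  - by rewrite -addbA addbb addbF.
have flip_acc b w : foldl flip b w = b (+) foldl flip false w.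
  elim: w b => [|a w IH] b /=; first by rewrite addbF.
  by rewrite IH [in RHS]IH /flip /= addbA.
have [w wE] := cls_surj gu; rewrite -wE in E.
have := flipP ((x, false) :: w) (rcons w (pact pu x, false)).
rewrite cls_cons cls_rcons E => /(_ erefl).
rewrite -cats1 foldl_cat /= flip_acc /flip /= eqxx.
by case: (foldl _ _ _); case: eqP.
Qed.

End VirtualGroup.

(** * The virtual braid and virtual twin groups as instances *)

Lemma farP n (i j : 'I_n.-1) : far i j <-> farb i j.
Proof. by split=> /orP. Qed.

Lemma vb_no_abelian_normal n : (2 < n)%N ->
  no_nontrivial_abelian_normal_in (@vb_rel n) (ker_perm (@piK_gen n)).
Proof.
move=> hn; pose dec (t : vbgen n) : 'I_n.-1 + 'I_n.-1 :=
  match t with VBs i => inl i | VBv i => inr i end.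
have -> : @piK_gen n = vperm dec by apply: funext; case.
apply: (@no_abelian_normal_kernel n false hn _ _ (@VBs n) (@VBv n)) => //; first by case.
- move=> l r; case=> [i j ij|i j /farP ij|i|i j ij|i j /farP ij|i j /farP ij|i j ij] o.
  + exact: vstep_snext.
  + exact: vstep_sfar.
  + exact: vstep_vsq.
  + exact: vstep_vnext.
  + exact: vstep_vfar.
  + exact: vstep_svfar.
  + exact: vstep_mixed.
- by move=> i; have := cls_rel (vbr_vsq i); rewrite !cls_cons cls0 !mulg1.
- move=> i j /farP ij.
  by have := cls_rel (vbr_vcomm ij); rewrite !cls_cons cls0 !mulg1.
- move=> i j ij.
  by have := cls_rel (vbr_vbraid (ij : Defs.next i j)); rewrite !cls_cons cls0 !mulg1.
- move=> i j /farP ij.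
  by have := cls_rel (vbr_mcomm ij); rewrite !cls_cons cls0 !mulg1.
- move=> i j ij.
  by have := cls_rel (vbr_mixed (ij : Defs.next i j)); rewrite !cls_cons cls0 !mulg1.
- move=> i j /farP ij.
  by have := cls_rel (vbr_scomm ij); rewrite !cls_cons cls0 !mulg1.
- move=> i j _ ij.
  by have := cls_rel (vbr_sbraid (ij : Defs.next i j)); rewrite !cls_cons cls0 !mulg1.
Qed.

Section VirtualTwin.
Variable n : nat.
Hypothesis hn : (2 < n)%N.

Let dec (t : vtgen n) : 'I_n.-1 + 'I_n.-1 :=
  match t with VTs i => inl i | VTr i => inr i end.

Let theta_vperm : @theta_gen n = vperm dec.
Proof. by apply: funext; case. Qed.

Let stepR l r : vt_rel l r ->
  forall o, foldl (vstep (tw := true) dec) o l = foldl (vstep (tw := true) dec) o r.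
Proof.
case=> [i|i j /farP ij|i|i j /farP ij|i j ij|i j /farP ij|i j ij] o.
- exact: vstep_ssq.
- exact: vstep_sfar.
- exact: vstep_vsq.
- exact: vstep_vfar.
- exact: vstep_vnext.
- by apply: esym; apply: vstep_svfar => //; rewrite farb_sym.
- exact: vstep_mixed.
Qed.

Let si i := gen (@vt_rel n) (VTs i).
Let nu i := gen (@vt_rel n) (VTr i).

Let nu2 i : nu i * nu i = 1.
Proof. by have := cls_rel (vtr_rsq i); rewrite !cls_cons cls0 !mulg1. Qed.
Let nu_far i j : farb i j -> nu i * nu j = nu j * nu i.
Proof. by move/farP=> ij; have := cls_rel (vtr_rcomm ij); rewrite !cls_cons cls0 !mulg1. Qed.
Let nu_next (i j : 'I_n.-1) : j = i.+1 :> nat -> nu i * (nu j * nu i) = nu j * (nu i * nu j).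
Proof.
by move=> ij; have := cls_rel (vtr_rbraid (ij : Defs.next i j)); rewrite !cls_cons cls0 !mulg1.
Qed.
Let si_nu_far i j : farb i j -> si i * nu j = nu j * si i.
Proof.
rewrite farb_sym => /farP ij.
by have := cls_rel (vtr_mcomm ij); rewrite !cls_cons cls0 !mulg1 => <-.
Qed.
Let mixed (i j : 'I_n.-1) : j = i.+1 :> nat -> nu i * (nu j * si i) = si j * (nu i * nu j).
Proof.
by move=> ij; have := cls_rel (vtr_mixed (ij : Defs.next i j)); rewrite !cls_cons cls0 !mulg1.
Qed.
Let si_far i j : farb i j -> si i * si j = si j * si i.
Proof. by move/farP=> ij; have := cls_rel (vtr_scomm ij); rewrite !cls_cons cls0 !mulg1. Qed.
Let si_sq i : si i * si i = 1.
Proof. by have := cls_rel (vtr_ssq i); rewrite !cls_cons cls0 !mulg1. Qed.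

Lemma vt_theta_no_abelian_normal :
  no_nontrivial_abelian_normal_in (@vt_rel n) (ker_perm (@theta_gen n)).
Proof.
rewrite theta_vperm.
apply: (@no_abelian_normal_kernel n true hn _ _ (@VTs n) (@VTr n)) => //; first by case.
by move=> i _; exact: si_sq.
Qed.

Lemma vt_abelian_normal_theta N : normal_abelian_subgroup (@vt_rel n) N ->
  forall u, N u -> ker_perm (@theta_gen n) u.
Proof.
rewrite theta_vperm.
apply: (@abelian_normal_sub_kernel n true hn _ _ (@VTs n) (@VTr n)) => //; first by case.
by move=> i _; exact: si_sq.
Qed.

End VirtualTwin.

Theorem theorem5p17 (n : nat) (hn : (3 <= n)%N) :
  no_nontrivial_abelian_normal_in (@vb_rel n) (ker_perm (@piK_gen n)) /\
  no_nontrivial_abelian_normal_in (@vt_rel n) (ker_perm (@sigma_gen n)) /\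
  no_nontrivial_abelian_normal_in (@vt_rel n) (ker_perm (@theta_gen n)).
Proof.
split; first exact: vb_no_abelian_normal.
split; last exact: vt_theta_no_abelian_normal.
(* Abelian normal subgroups of VT_n lie in the kernel of theta, which reduces this case to the third
   one. *)
move=> N nN _; apply: (vt_theta_no_abelian_normal hn nN).
exact: vt_abelian_normal_theta hn _ nN.
Qed.
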